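(* Let $\lambda\ge2$ and $0<p\le1$. For any choice of $F_1>0$ and $F_2>0$, let $F_{n+2}=\lambda F_{n+1}\pm F_n$ for $n\ge1$, where the $\pm$ signs are independent, each being $+$ with probability $p$ and $-$ with probability $1-p$. Then $$\frac1n\log|F_n|\xrightarrow[n\to\infty]{}\gamma_{p,\lambda}=\int_0^\infty\log x\,d\mu_{p,\lambda}(x)>0\quad\text{almost surely},$$ where $\mu_{p,\lambda}$ is the probability measure supported on $\left[B,\lambda+\frac1B\right]$, $B=\frac{\lambda+\sqrt{\lambda^2-4}}2$, given by $\mu_{p,\lambda}(I_W)=p^{|W|_R}(1-p)^{|W|_L}$ for every finite nonempty word $W$ in the letters $R,L$ (the intervals $I_W$ are defined in the context).
   Context: Let $f_R(q)=\lambda+1/q$ and $f_L(q)=\lambda-1/q$, with $1/\infty=0$. Define intervals indexed by finite words in $\{R,L\}$ inductively by $I_R=f_R([B,\infty])=[\lambda,\lambda+\frac1B]$, $I_L=f_L([B,\infty])=[B,\lambda]$, and $I_{XR}=f_R(I_X)$, $I_{XL}=f_L(I_X)$ for every nonempty finite word $X$. $|W|_R$ and $|W|_L$ denote the number of letters $R$, respectively $L$, in $W$. The convention $0^0=1$ is used when $p=1$. *)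

(* Defs.v *)
From HB Require Import structures.
From mathcomp Require Export all_boot all_order all_algebra.
From mathcomp Require Export all_classical all_reals all_analysis.

Set Implicit Arguments.
Unset Strict Implicit.
Unset Printing Implicit Defensive.

Import Order.TTheory GRing.Theory Num.Theory.
Import numFieldNormedType.Exports.

Local Open Scope classical_set_scope.
Local Open Scope ring_scope.

(* Mutual independence of the family (X i)_{i in D}: the product rule over
   every finite subfamily, for arbitrary measurable sets A i. *)
Definition mutually_independent (R : realType) (d : measure_display)
    (Omega : measurableType d) (P : probability Omega R)
    (d' : measure_display) (T : measurableType d') (I : choiceType)
    (D : set I) (X : I -> {RV P >-> T}) : Prop :=
  forall (J : seq I) (A : I -> set T),
    uniq J -> [set` J] `<=` D -> (forall i, i \in J -> measurable (A i)) ->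
    P (\bigcap_(i in [set` J]) (X i @^-1` A i)) =
      (\prod_(i <- J) P (X i @^-1` A i))%E.

Arguments mutually_independent {R d Omega} P {d' T I} D X.

(* Letters are booleans: [true] is R (the sign +), [false] is L (the sign -).
   Words are read from left to right. *)
Notation letter := bool (only parsing).
Notation letter_R := true (only parsing).
Notation letter_L := false (only parsing).

(* The maps live on the extended reals because they are applied to [B, +oo];
   the library inverse satisfies +oo^-1 = 0. *)
Definition f_ (R : realType) (lambda : R) (c : letter) (q : \bar R) : \bar R :=
  if c then (lambda%:E + q^-1)%E else (lambda%:E - q^-1)%E.

Definition B_ (R : realType) (lambda : R) : R :=
  (lambda + Num.sqrt (lambda ^+ 2 - 4)) / 2.

(* [foldl] applies the map of the last letter of W last (outermost), that is
   I_{Xc} = f_c(I_X); the empty word gives [B, +oo]. *)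
Definition I_ (R : realType) (lambda : R) (W : seq letter) : set (\bar R) :=
  foldl (fun A c => f_ lambda c @` A)
        [set q : \bar R | ((B_ lambda)%:E <= q)%E] W.

Definition is_mu (R : realType) (lambda p : R)
    (mu : probability (measurableTypeR R) R) : Prop :=
  mu [set` `[B_ lambda, lambda + (B_ lambda)^-1]] = 1%E /\
  forall W : seq letter, W != [::] ->
    mu [set x : R | I_ lambda W x%:E] =
      (p ^+ count_mem letter_R W * (1 - p) ^+ count_mem letter_L W)%:E.

(* Main.v *)
From HB Require Import structures.
Require Import Defs.
From mathcomp Require Import all_boot all_order all_algebra.
From mathcomp Require Import all_classical all_reals all_analysis measurable_realfun.
From mathcomp Require Import ring lra zify.

(** The ratio [x n = F n.+1 / F n] of a recurrence driven by signs satisfies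
    [x n.+1 = lambda + 1 / x n] or [x n.+1 = lambda - 1 / x n], so that
    [ln `|F n|] is, up to a constant, the sum of the [ln (x k)], and everything
    rests on the random iteration of the two maps [lambda + 1 / y] and
    [lambda - 1 / y].

    Both maps send the half-line of the [y >= B] into
    the interval from [B] to [lambda + 1 / B], because [B + 1 / B = lambda] ([mobius_bound]). There
    they contract: the distance [t] of two points becomes at most [t / (1 + t)],
    so after [n] maps it is at most [1 / n], whatever the word
    ([mobius_word_contract]). For [lambda = 2] the map [2 - 1 / y] has derivative
    1 at its fixed point 1, hence nothing faster than [1 / n] can hold uniformly;
    [1 / n] is enough for all that follows.

    Uniqueness of the measure. Two intervals [I_{RX}] and [I_{LX}] meet in one
    point, the image of [lambda] under the word [X]. If a measure with the
    prescribed masses charged this point, it would charge the corresponding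
    points of all the words [L...LX] at least as much, whereas these lie in
    intervals of mass at most a power of [1 - p]; so there is no mass there
    ([breakpoint_null]). Consequently the intervals of a given length carry the
    whole measure without overlap ([words_integral]). As they have diameter
    [1 / n] and known masses, two such measures compare half-lines up to a shift
    by [1 / n], and they agree ([is_mu_unique]).

    Existence. Split the interval [0 <= u < 1] at [1 - p]; each piece is an affine copy of the
    whole. Reading which pieces a point visits produces an infinite word with
    independent letters under Lebesgue measure, and the limit of the composed
    maps along this word defines [coding]. Its law has the prescribed masses
    because cutting off the first digit acts on Lebesgue measure as on words
    ([leb_digit_shift], [is_mu_exists]).

    Growth rate. By contraction, [ln (x (k + m))] is within [1 / m] of a function
    of the window of [m] signs that starts at [k], and the integral of [ln] is
    within [1 / m] of the mean of the same function ([log_integral_words]). It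
    remains that every word [W] appears along the signs with frequency
    [word_prob p W] almost surely ([window_frequency]). This is a strong law
    for events that are independent as soon as their indices are [m] apart: the
    centred sums have second moment of order [n], so the means of their squares
    divided by [n ^ 2] are summable along the perfect squares, and the sums move
    by at most 1 at each step ([frequency_cvg]).

    The ratios have to enter the half-line first. As long as they have not,
    at most one of the two signs keeps them out; hence the signs that never let
    them in form a single sequence, determined by the initial values, and a
    single sequence has probability 0 ([eventually_cone], [letters_differ]). *)

Import Order.TTheory GRing.Theory Num.Theory.
Import numFieldNormedType.Exports.
Local Open Scope classical_set_scope.
Local Open Scope ring_scope.
Set Implicit Arguments.
Unset Strict Implicit.
Unset Printing Implicit Defensive.

(** * The two maps and the intervals they generate *)

Section maps.
Context {R : realType}.
Implicit Types (lambda y z : R) (c : bool) (W X : seq bool).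

(** The maps [f_] away from their poles: on finite nonzero points the extended
    reals of the statement can be avoided ([f_EFin]). With [0^-1 = 0] both maps
    are bijections of the real line, which makes injectivity unconditional. *)
Definition mobius lambda c y : R := if c then lambda + y^-1 else lambda - y^-1.

Definition mobius_word lambda W y : R := foldl (fun z c => mobius lambda c z) y W.

(** The intervals of the one-letter words; the other ones are their images under
    maps of the real line ([I_cons]). *)
Definition first_itv lambda c : set R :=
  if c then [set` `[lambda, lambda + (B_ lambda)^-1]]
  else [set` `[B_ lambda, lambda]].

Lemma B_ge1 lambda : 2 <= lambda -> 1 <= B_ lambda.
Proof.
move=> h; rewrite /B_ ler_pdivlMr// mul1r.
by have := sqrtr_ge0 (lambda ^+ 2 - 4); lra.
Qed.

Lemma B_gt0 lambda : 2 <= lambda -> 0 < B_ lambda.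
Proof. by move=> /B_ge1; apply: lt_le_trans. Qed.

(** [B] is the larger root of [y ^ 2 - lambda y + 1], that is, the larger
    fixed point of [lambda - 1 / y]. *)
Lemma B_addV lambda : 2 <= lambda -> B_ lambda + (B_ lambda)^-1 = lambda.
Proof.
move=> h; have B0 : B_ lambda != 0 by rewrite gt_eqF// B_gt0.
apply: (mulfI B0); rewrite mulrDr divff// /B_.
have h4 : 0 <= lambda ^+ 2 - 4 by nra.
have := sqr_sqrtr h4; set s := Num.sqrt _ => hs.
nra.
Qed.

Lemma mobius_bound lambda c y : 2 <= lambda -> B_ lambda <= y ->
  B_ lambda <= mobius lambda c y <= lambda + (B_ lambda)^-1.
Proof.
move=> h By; have B0 := B_gt0 h; have hB := B_addV h.
have y0 : 0 < y by exact: lt_le_trans By.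
have yB : y^-1 <= (B_ lambda)^-1 by rewrite lef_pV2 ?posrE.
have yi : 0 < y^-1 by rewrite invr_gt0.
by rewrite /mobius; case: c; lra.
Qed.

Lemma mobius_R_gt lambda y : 0 < y -> lambda < mobius lambda true y.
Proof. by move=> y0; rewrite /mobius ltrDl invr_gt0. Qed.

Lemma mobius_L_lt lambda y : 0 < y -> mobius lambda false y < lambda.
Proof. by move=> y0; rewrite /mobius ltrBlDr ltrDl invr_gt0. Qed.

Lemma mobius_inj lambda c : injective (mobius lambda c).
Proof. by move=> y z; case: c => [/addrI|/addrI/oppr_inj] /invr_inj. Qed.

Lemma mobius_word_inj lambda W : injective (mobius_word lambda W).
Proof. by elim: W => [//|c W IH] y z /IH /mobius_inj. Qed.

Lemma mobius_word_ge lambda W y : 2 <= lambda -> B_ lambda <= y ->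
  B_ lambda <= mobius_word lambda W y.
Proof.
move=> h; elim: W y => [//|c W IH] y By /=; apply: IH.
by case/andP: (mobius_bound c h By).
Qed.

(** The distance [t] of two points is divided by their product, and the larger of
    them is at least [1 + t]. *)
Lemma mobius_dist lambda c y z : 1 <= y -> 1 <= z ->
  `|mobius lambda c y - mobius lambda c z| * (1 + `|y - z|) <= `|y - z|.
Proof.
move=> y1 z1.
have y0 : y != 0 by rewrite gt_eqF// (lt_le_trans _ y1).
have z0 : z != 0 by rewrite gt_eqF// (lt_le_trans _ z1).
have -> : `|mobius lambda c y - mobius lambda c z| = `|y - z| / (y * z).
  transitivity `|y^-1 - z^-1|; first by rewrite /mobius; case: c;
    [congr `| _ |; ring|rewrite -normrN; congr `| _ |; ring].
  have -> : y^-1 - z^-1 = - ((y - z) / (y * z)).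
    by field; rewrite y0 z0.
  rewrite normrN normrM; congr (_ * _); rewrite ger0_norm// invr_ge0.
  by apply: mulr_ge0; lra.
have yz : 0 < y * z by apply: mulr_gt0; lra.
rewrite -mulrA ler_piMr// mulrC ler_pdivrMr// mul1r.
have [yz'|yz'] := leP z y.
  by rewrite ger0_norm ?subr_ge0//; nra.
by rewrite ltr0_norm ?subr_lt0//; nra.
Qed.

(** Induction on the last letter: if [n * t <= 1], then
    [(n + 1) * (t / (1 + t)) <= 1]. *)
Lemma mobius_word_contract lambda W y z : 2 <= lambda ->
  B_ lambda <= y -> B_ lambda <= z ->
  (size W)%:R * `|mobius_word lambda W y - mobius_word lambda W z| <= 1.
Proof.
move=> h; elim/last_ind: W => [|W c IH] By Bz; first by rewrite mul0r.
have {IH} := IH By Bz; rewrite /mobius_word size_rcons -cats1 !foldl_cat /=.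
rewrite -!/(mobius_word _ _ _).
have := mobius_word_ge W h By; have := mobius_word_ge W h Bz.
have B1 := B_ge1 h.
move: (mobius_word lambda W y) (mobius_word lambda W z) => {By Bz}y {}z Bz By.
have := @mobius_dist lambda c y z (le_trans B1 By) (le_trans B1 Bz).
have := normr_ge0 (y - z).
have := normr_ge0 (mobius lambda c y - mobius lambda c z).
rewrite -natr1; have := ler0n R (size W).
move: `|mobius _ _ _ - _| `|y - z| ((size W)%:R) => a b n; nra.
Qed.

Lemma f_EFin lambda c y : y != 0 -> f_ lambda c y%:E = (mobius lambda c y)%:E.
Proof. by move=> y0; rewrite /f_ /mobius inver (negbTE y0); case: c. Qed.

Lemma f_pinfty lambda c : f_ lambda c +oo%E = lambda%:E.
Proof. by case: c; rewrite /f_ invey ?sube0 ?adde0. Qed.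

Lemma I_single lambda c : 2 <= lambda ->
  I_ lambda [:: c] = EFin @` first_itv lambda c.
Proof.
move=> h; have B0 := B_gt0 h; have hB := B_addV h.
apply/seteqP; split=> [_ [q /= Bq <-]|_ [x xI <-]] /=.
  case: q Bq => [y| |]//=.
    rewrite lee_fin => By; have y0 : 0 < y by exact: lt_le_trans By.
    rewrite f_EFin ?gt_eqF//; exists (mobius lambda c y) => //.
    have := @mobius_bound lambda c y h By.
    have := @mobius_R_gt lambda y y0; have := @mobius_L_lt lambda y y0.
    by case: c; rewrite /= in_itv /=; move=> *; lra.
  rewrite f_pinfty => _; exists lambda => //.
  have : 0 < (B_ lambda)^-1 by rewrite invr_gt0.
  by case: c; rewrite /= in_itv /= => *; lra.
have [xl|xl] := eqVneq x lambda.
  by exists +oo%E; [rewrite /= leey|rewrite f_pinfty xl].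
have d0 : 0 < (B_ lambda)^-1 by rewrite invr_gt0.
have key z : 0 < z <= (B_ lambda)^-1 -> B_ lambda <= z^-1.
  by case/andP=> z0 zB; rewrite -[leLHS]invrK lef_pV2 ?posrE// ?invr_gt0.
have [t0 tB tE] : [/\ 0 < (if c then x - lambda else lambda - x),
    (if c then x - lambda else lambda - x) <= (B_ lambda)^-1 &
    (if c then lambda + (x - lambda) else lambda - (lambda - x)) = x].
  move: xI xl; case: (c); rewrite /= in_itv /= => /andP[x1 x2] xl.
    have x0 : lambda < x by rewrite lt_neqAle eq_sym xl.
    by split; lra.
  have x0 : x < lambda by rewrite lt_neqAle xl.
  by split; lra.
exists (if c then x - lambda else lambda - x)^-1%:E.
  by rewrite /= lee_fin key// t0.
rewrite f_EFin ?invr_neq0 ?gt_eqF// /mobius invrK.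
by case: c tE {t0 tB xI} => ->.
Qed.

Lemma first_itv_bound lambda c y : 2 <= lambda -> first_itv lambda c y ->
  B_ lambda <= y <= lambda + (B_ lambda)^-1.
Proof.
move=> h; have B0 := B_gt0 h; have hB := B_addV h.
have d0 : 0 < (B_ lambda)^-1 by rewrite invr_gt0.
by case: c; rewrite /= in_itv /= => *; lra.
Qed.

Lemma I_cons lambda c X : 2 <= lambda ->
  I_ lambda (c :: X) = EFin @` (mobius_word lambda X @` first_itv lambda c).
Proof.
move=> h; elim/last_ind: X => [|X d IH].
  by rewrite I_single// image_id.
rewrite -rcons_cons /I_ -cats1 foldl_cat -/(I_ lambda (c :: X)) IH /=.
rewrite -[mobius_word lambda (rcons X d)]/(foldl _ ^~ (rcons X d)).
apply/seteqP; split=> [_ [_ [_ [y yI <-] <-] <-]|_ [_ [y yI <-] <-]].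
  rewrite f_EFin; last first.
    rewrite gt_eqF//; apply: lt_le_trans (B_gt0 h) _; apply: mobius_word_ge => //.
    by case/andP: (first_itv_bound h yI).
  exists (mobius_word lambda (rcons X d) y) => //; first by exists y.
  by rewrite /mobius_word -cats1 foldl_cat.
exists (mobius_word lambda X y)%:E; first by exists (mobius_word lambda X y) => //; exists y.
rewrite f_EFin /=; first by rewrite /mobius_word -cats1 foldl_cat.
rewrite gt_eqF//; apply: lt_le_trans (B_gt0 h) _; apply: mobius_word_ge => //.
by case/andP: (first_itv_bound h yI).
Qed.

Lemma I_real lambda c X : 2 <= lambda ->
  [set x : R | I_ lambda (c :: X) x%:E] = mobius_word lambda X @` first_itv lambda c.
Proof.
move=> h; rewrite I_cons//; apply/seteqP; split=> [x /= [y yI [<-//]]|x xI /=].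
by exists x.
Qed.

End maps.

Section cells.
Context {R : realType}.
Implicit Types (lambda p y z : R) (c : bool) (W X : seq bool).

(** For the empty word this is the half-line of the [y >= B], so that splitting a
    cell by the letter put in front of its word makes sense from the start. *)
Definition cell lambda W : set R := [set x | I_ lambda W x%:E].

Definition letter_prob p c := if c then p else 1 - p.

Definition word_prob p W := \prod_(c <- W) letter_prob p c.

(** The words of length [m]; adding a letter in front composes with one more map
    on the inside, which cuts the corresponding cell in two. *)
Definition words m : seq (seq bool) :=
  iter m (fun ws => map (cons true) ws ++ map (cons false) ws) [:: [::]].

Lemma big_wordsS (V : nmodType) m (F : seq bool -> V) :
  \sum_(W <- words m.+1) F W =
  \sum_(W <- words m) (F (true :: W) + F (false :: W)).
Proof. by rewrite /= big_cat/= !big_map big_split. Qed.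

Lemma size_words m W : W \in words m -> size W = m.
Proof.
elim: m W => [|m IH] W /=; first by rewrite inE => /eqP ->.
by rewrite mem_cat => /orP[] /mapP[X /IH <- ->].
Qed.

Lemma words_uniq m : uniq (words m).
Proof.
elim: m => [//|m IH] /=; rewrite cat_uniq !map_inj_uniq ?IH//=; last 2 first.
- by move=> ? ? [].
- by move=> ? ? [].
by rewrite andbT; apply/hasPn => _ /mapP[X _ ->]; apply/mapP => -[].
Qed.

Lemma mem_words W : W \in words (size W).
Proof.
elim: W => [//|c W IH] /=; rewrite mem_cat.
by apply/orP; case: c; [left|right]; exact: map_f.
Qed.

Lemma word_probE p W :
  p ^+ count_mem true W * (1 - p) ^+ count_mem false W = word_prob p W.
Proof.
rewrite /word_prob; elim: W => [|c W IH]; first by rewrite big_nil mulr1.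
rewrite big_cons -IH; case: c => /=; rewrite ?add0n ?add1n ?exprS; ring.
Qed.

Lemma word_prob_cons p c W : word_prob p (c :: W) = letter_prob p c * word_prob p W.
Proof. exact: big_cons. Qed.

Lemma word_prob_ge0 p W : 0 <= p <= 1 -> 0 <= word_prob p W.
Proof.
by move=> /andP[p0 p1]; apply: prodr_ge0 => -[] _ //=; rewrite subr_ge0.
Qed.

Lemma sum_word_prob p m : \sum_(W <- words m) word_prob p W = 1.
Proof.
elim: m => [|m IH]; first by rewrite big_seq1 /word_prob big_nil.
rewrite big_wordsS -[RHS]IH; apply: eq_bigr => W _.
by rewrite !word_prob_cons -mulrDl addrC subrK mul1r.
Qed.

Lemma cell_nil lambda : cell lambda [::] = [set` `[B_ lambda, +oo[].
Proof. by apply/seteqP; split=> x; rewrite /cell /I_ /= in_itv /= andbT lee_fin. Qed.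

Lemma cell_cons lambda c X : 2 <= lambda ->
  cell lambda (c :: X) = mobius_word lambda X @` first_itv lambda c.
Proof. exact: I_real. Qed.

Lemma cell_ge lambda W x : 2 <= lambda -> cell lambda W x -> B_ lambda <= x.
Proof.
move=> h; case: W => [|c X]; first by rewrite cell_nil /= in_itv /= andbT.
by rewrite cell_cons// => -[y /(first_itv_bound h) /andP[By _] <-]; exact: mobius_word_ge.
Qed.

Lemma cell_diam lambda c X x y : 2 <= lambda ->
  cell lambda (c :: X) x -> cell lambda (c :: X) y ->
  (size X)%:R * `|x - y| <= 1.
Proof.
move=> h; rewrite !cell_cons// => -[u /(first_itv_bound h) /andP[Bu _] <-].
by move=> [v /(first_itv_bound h) /andP[Bv _] <-]; exact: mobius_word_contract.
Qed.

(** The first letter of a word is the innermost map, and it sends the half-line of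
    the [y >= B] into the interval of the next letter. *)
Lemma cell_cons_sub lambda c W : 2 <= lambda ->
  cell lambda (c :: W) `<=` cell lambda W.
Proof.
move=> h; have B0 := B_gt0 h; have hB := B_addV h.
rewrite cell_cons//; case: W => [|d X].
  rewrite cell_nil /= => _ [y /(first_itv_bound h) /andP[By _] <-] /=.
  by rewrite in_itv /= andbT.
rewrite cell_cons// => _ [y /(first_itv_bound h) /andP[By _] <-].
exists (mobius lambda d y) => //.
have y0 : 0 < y by exact: lt_le_trans By.
have := mobius_bound d h By; have := mobius_R_gt lambda y0.
have := mobius_L_lt lambda y0.
by case: d; rewrite /= in_itv /= => *; lra.
Qed.

(** The one-letter intervals share [lambda], the image of infinity; the maps are
    injective, so that nothing else is shared later. *)
Lemma cell_overlap lambda W : 2 <= lambda ->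
  cell lambda (true :: W) `&` cell lambda (false :: W) = [set mobius_word lambda W lambda].
Proof.
move=> h; have d0 : 0 < (B_ lambda)^-1 by rewrite invr_gt0 B_gt0.
have hB := B_addV h.
rewrite !cell_cons//; apply/seteqP; split=> [_ [[y yI <-] [z zI /mobius_word_inj zy]]|_ ->].
  subst z; congr (mobius_word lambda W _).
  by move: yI zI => /=; rewrite !in_itv /= => *; lra.
by split; exists lambda => //=; rewrite in_itv /=; lra.
Qed.

(** The point [lambda] is an image of infinity only, and the maps never return to
    infinity; deeper intervals therefore stay away from the break point. *)
Lemma cell_overlap_notin lambda c d W : 2 <= lambda ->
  ~ cell lambda (c :: d :: W) (mobius_word lambda W lambda).
Proof.
move=> h; rewrite cell_cons// => -[y /(first_itv_bound h) /andP[By _]] /= /mobius_word_inj.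
have y0 : 0 < y by exact: lt_le_trans (B_gt0 h) By.
have := mobius_R_gt lambda y0; have := mobius_L_lt lambda y0.
by case: d => *; lra.
Qed.

Lemma invr_measurable : measurable_fun [set: R] (@GRing.inv R).
Proof.
rewrite -(setvU [set (0 : R)]) => //; apply/measurable_funU => //.
  exact: measurableC.
split; last exact: measurable_fun_set1.
apply: open_continuous_measurable_fun.
  by rewrite openC; exact: closed_eq.
move=> x; rewrite inE /= => /eqP x0; exact: inv_continuous.
Qed.

Lemma mobius_measurable lambda c : measurable_fun [set: R] (mobius lambda c).
Proof.
rewrite /mobius; case: c.
  by apply: measurable_funD => //; exact: invr_measurable.
by apply: measurable_funB => //; exact: invr_measurable.
Qed.

(** The map has an explicit measurable inverse, so images are preimages. *)
Lemma mobius_image_measurable lambda c (A : set R) : measurable A ->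
  measurable (mobius lambda c @` A).
Proof.
move=> mA; pose g (x : R) := if c then (x - lambda)^-1 else (lambda - x)^-1.
have -> : mobius lambda c @` A = g @^-1` A.
  rewrite /g /mobius; apply/seteqP; split=> [_ [y Ay <-]|x Ax] /=.
    suff -> : (if c then ((if c then lambda + y^-1 else lambda - y^-1) - lambda)^-1
      else (lambda - (if c then lambda + y^-1 else lambda - y^-1))^-1) = y by [].
    by rewrite -[RHS]invrK; case: (c); congr (_^-1); ring.
  by move: Ax; case: (c) => Ax; eexists; try exact: Ax; rewrite invrK; ring.
rewrite -[X in measurable X]setTI; apply: (_ : measurable_fun setT g) => //.
rewrite /g; case: (c).
  apply: measurableT_comp; first exact: invr_measurable.
  exact: measurable_funB.
apply: measurableT_comp; first exact: invr_measurable.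
exact: measurable_funB.
Qed.

Lemma cell_measurable lambda W : 2 <= lambda -> measurable (cell lambda W).
Proof.
move=> h; case: W => [|c X]; first by rewrite cell_nil.
rewrite cell_cons//; have : measurable (first_itv lambda c).
  by rewrite /first_itv; case: (c); exact: measurable_itv.
elim: X (first_itv lambda c) => [|d X IH] A mA; first by rewrite image_id.
have -> : mobius_word lambda (d :: X) @` A = mobius_word lambda X @` (mobius lambda d @` A).
  by rewrite image_comp.
by apply: IH; exact: mobius_image_measurable.
Qed.

End cells.

(** * Measures with the prescribed masses: no atoms at the break points, uniqueness *)

Section probability_facts.
Context {d} {T : measurableType d} {R : realType} (P : probability T R).
Implicit Types A B : set T.

Lemma fine_prob_le A B : measurable A -> measurable B -> A `<=` B ->
  fine (P A) <= fine (P B).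
Proof.
move=> mA mB AB; rewrite fine_le ?fin_num_measure//.
by apply: le_measure => //; rewrite inE.
Qed.

Lemma fine_probU A B : measurable A -> measurable B ->
  fine (P (A `|` B)) = fine (P A) + fine (P B) - fine (P (A `&` B)).
Proof.
move=> mA mB; rewrite measureUfinr//; last first.
  by rewrite -ge0_fin_numE// fin_num_measure.
have mAB : measurable (A `&` B) by exact: measurableI.
by rewrite fineB ?fineD ?fin_numD ?fin_num_measure// !fin_num_measure.
Qed.

Lemma fine_probD A B : measurable A -> measurable B -> B `<=` A ->
  fine (P (A `\` B)) = fine (P A) - fine (P B).
Proof.
move=> mA mB BA; rewrite measureD//; last first.
  by rewrite -ge0_fin_numE// fin_num_measure.
by rewrite setIidr// fineB ?fin_num_measure.
Qed.

Lemma prob_eq0 A : measurable A -> fine (P A) = 0 -> P A = 0%E.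
Proof. by move=> mA h; rewrite -(fineK (fin_num_measure P A mA)) h. Qed.

(** By the hypothesis on the masses, [A1] and [A2] cover [A] up to a null set. *)
Lemma ge0_integral_ae_split A A1 A2 (f : T -> \bar R) :
  measurable A -> measurable A1 -> measurable A2 ->
  A1 `<=` A -> A2 `<=` A ->
  fine (P A) = fine (P A1) + fine (P A2) -> P (A1 `&` A2) = 0%E ->
  measurable_fun A f -> (forall x, A x -> (0 <= f x)%E) ->
  (\int[P]_(x in A) f x = \int[P]_(x in A1) f x + \int[P]_(x in A2) f x)%E.
Proof.
move=> mA mA1 mA2 s1 s2 PA P12 mf f0.
have mU : measurable (A1 `|` A2) by exact: measurableU.
have mI : measurable (A1 `&` A2) by exact: measurableI.
have mD : measurable (A `\` (A1 `|` A2)) by exact: measurableD.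
have PD : P (A `\` (A1 `|` A2)) = 0%E.
  apply: prob_eq0 => //; rewrite fine_probD//; last by move=> x [/s1|/s2].
  by rewrite fine_probU// P12 PA subr0 subrr.
have m12 : measurable (A1 `\` A2) by exact: measurableD.
have m21 : measurable (A2 `\` A1) by exact: measurableD.
rewrite (@ge0_negligible_integral _ _ _ P A
  ((A `\` (A1 `|` A2)) `|` (A1 `&` A2)))//; last 2 first.
- exact: measurableU.
- by rewrite measureU0.
rewrite (@ge0_negligible_integral _ _ _ P A1 (A1 `&` A2))//; last 2 first.
- exact: measurable_funS mf.
- by move=> x /s1 /f0.
rewrite (@ge0_negligible_integral _ _ _ P A2 (A1 `&` A2))//; last 2 first.
- exact: measurable_funS mf.
- by move=> x /s2 /f0.
have -> : A1 `\` (A1 `&` A2) = A1 `\` A2.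
  by apply/seteqP; split=> x /=; tauto.
have -> : A2 `\` (A1 `&` A2) = A2 `\` A1.
  by apply/seteqP; split=> x /=; tauto.
have -> : A `\` (A `\` (A1 `|` A2) `|` A1 `&` A2) = (A1 `\` A2) `|` (A2 `\` A1).
  apply/seteqP; split=> x /=; last by move: (s1 x) (s2 x); tauto.
  by case: (pselect (A1 x)); case: (pselect (A2 x)); tauto.
rewrite ge0_integral_setU//.
- by apply: measurable_funS mf => // x [[/s1]|[/s2]].
- by move=> x [[/s1 + _]|[/s2 + _]] => /f0.
- by apply/disj_setPRL => x /= [? ?] [].
Qed.

End probability_facts.

Section continued_fraction_measure.
Context {R : realType}.
Variables (lambda p : R) (nu : probability (measurableTypeR R) R).
Hypotheses (h : 2 <= lambda) (p0 : 0 < p) (p1 : p <= 1).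
Hypothesis nuP : is_mu lambda p nu.
Implicit Types (W X : seq bool) (D : set R).

Local Notation cell := (cell lambda).
Local Notation prob D := (fine (nu D)).

Let mcell W : measurable (cell W : set (measurableTypeR R)) := cell_measurable W h.

Lemma prob_cell W : prob (cell W) = word_prob p W.
Proof.
case: W => [|c X]; last by rewrite /cell nuP.2// word_probE.
rewrite cell_nil /word_prob big_nil.
apply/eqP; rewrite eq_le; apply/andP; split.
  by rewrite -lee_fin fineK ?fin_num_measure// probability_le1.
have -> : 1 = prob [set` `[B_ lambda, lambda + (B_ lambda)^-1]] by rewrite nuP.1.
apply: fine_prob_le => //.
by apply: subset_itvl; rewrite bnd_simp.
Qed.

Let atom X := prob [set mobius_word lambda X lambda].

(** Both halves of the cell of [c :: X] avoid the break point of [X], although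
    this point lies in the cell. Hence the masses of the two halves can add up to
    the mass of the cell only if they count an overlap of at least the mass of
    that point, and the overlap is the break point of [c :: X]. *)
Let atom_cons X c : atom X <= atom (c :: X).
Proof.
have sub : cell (true :: c :: X) `|` cell (false :: c :: X) `<=`
    cell (c :: X) `\` [set mobius_word lambda X lambda].
  move=> x [] cx; split; try exact: cell_cons_sub cx;
    by move=> xE; move: cx; rewrite xE; exact: cell_overlap_notin.
have mU : measurable (cell (true :: c :: X) `|` cell (false :: c :: X)
    : set (measurableTypeR R)).
  exact: measurableU.
have m1 : measurable ([set mobius_word lambda X lambda] : set (measurableTypeR R)) by [].
have zc : [set mobius_word lambda X lambda] `<=` cell (c :: X).
  by rewrite -(cell_overlap X h); case: c {sub mU} => x [].
have := fine_prob_le nu mU (measurableD (mcell _) m1) sub.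
rewrite fine_probU// fine_probD// cell_overlap// !prob_cell !word_prob_cons.
rewrite -/(atom X) -/(atom (c :: X)) /letter_prob /=; lra.
Qed.

(** Putting letters [L] in front does not decrease the mass of the break point,
    but confines it to cells of mass at most [(1 - p) ^ n]. *)
Lemma breakpoint_null X : nu [set mobius_word lambda X lambda] = 0%E.
Proof.
have m1 : measurable ([set mobius_word lambda X lambda] : set (measurableTypeR R)) by [].
apply: prob_eq0 => //; rewrite -/(atom X).
have p01 : 0 <= p <= 1 by rewrite ltW.
have ub n : atom X <= (1 - p) ^+ n.
  have : atom X <= atom (nseq n false ++ X).
    by elim: n => [//|n IH]; exact: le_trans IH (atom_cons _ _).
  move=> /le_trans; apply.
  apply: (@le_trans _ _ (word_prob p (false :: nseq n false ++ X))).
    rewrite -prob_cell; apply: fine_prob_le => //.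
    by rewrite -(cell_overlap _ h) => x [].
  have : word_prob p X <= 1.
    rewrite -prob_cell -lee_fin fineK ?fin_num_measure//.
    exact: probability_le1.
  have := word_prob_ge0 X p01.
  rewrite word_prob_cons.
  have -> : word_prob p (nseq n false ++ X) = (1 - p) ^+ n * word_prob p X.
    elim: n => [|n IH]; first by rewrite expr0 mul1r.
    by rewrite [LHS]word_prob_cons IH exprS mulrA.
  have : 0 <= (1 - p) ^+ n by rewrite exprn_ge0// subr_ge0.
  move: (word_prob p X) (_ ^+ n) => a b b0 a0 a1; rewrite /letter_prob /=.
  have ba1 : b * a <= b by rewrite ler_piMr.
  have ba0 : 0 <= b * a by exact: mulr_ge0.
  by move: (b * a) ba0 ba1 => t; nra.
apply/eqP; rewrite eq_le fine_ge0// andbT.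
rewrite leNgt; apply/negP => a0.
have : (1 - p) ^+ n @[n --> \oo] --> (0 : R).
  by apply: cvg_expr; rewrite ger0_norm ?subr_ge0// ltrBlDr ltrDl.
move=> /cvgr_lt /(_ _ a0) [n _ /(_ n (leqnn n))] /=.
by rewrite ltNge ub.
Qed.

Lemma cell_split_integral X (f : R -> \bar R) :
  measurable_fun [set: measurableTypeR R] f ->
  (forall x, cell X x -> (0 <= f x)%E) ->
  (\int[nu]_(x in cell X) f x = \int[nu]_(x in cell (true :: X)) f x +
     \int[nu]_(x in cell (false :: X)) f x)%E.
Proof.
move=> mf f0; apply: ge0_integral_ae_split => //; try exact: cell_cons_sub.
- by rewrite !prob_cell !word_prob_cons /letter_prob /=; ring.
- by rewrite cell_overlap// breakpoint_null.
- exact: measurable_funTS.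
Qed.

Lemma words_integral m (f : R -> \bar R) :
  measurable_fun [set: measurableTypeR R] f ->
  (forall x, B_ lambda <= x -> (0 <= f x)%E) ->
  (\int[nu]_(x in [set` `[B_ lambda, +oo[]) f x =
     \sum_(W <- words m) \int[nu]_(x in cell W) f x)%E.
Proof.
move=> mf f0; elim: m => [|m IH]; first by rewrite big_seq1 cell_nil.
rewrite IH big_wordsS; apply: eq_bigr => W _; apply: cell_split_integral => //.
by move=> x /(cell_ge h); exact: f0.
Qed.

Lemma prob_setI_half_line D : measurable (D : set (measurableTypeR R)) ->
  nu (D `&` [set` `[B_ lambda, +oo[]) = nu D.
Proof.
move=> mD.
have mB : measurable ([set` `[B_ lambda, +oo[] : set (measurableTypeR R)).
  exact: measurable_itv.
apply/esym; rewrite [LHS](measureDI _ mD mB) -[RHS]add0e; congr (_ + _)%E.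
apply: (@subset_measure0 _ _ _ nu _ (~` [set` `[B_ lambda, +oo[])).
- exact: measurableD.
- exact: measurableC.
- by rewrite setDE; exact: subIsetr.
- apply: prob_eq0; first exact: measurableC.
  rewrite probability_setC// -cell_nil fineB ?fin_num_measure// prob_cell.
  by rewrite /word_prob big_nil subrr.
Qed.

Lemma words_prob m D : measurable (D : set (measurableTypeR R)) ->
  prob D = \sum_(W <- words m) prob (D `&` cell W).
Proof.
move=> mD; rewrite -(prob_setI_half_line mD) -integral_indic//.
rewrite (@words_integral m)//; last first.
  exact/measurable_EFinP/measurable_indic.
under eq_bigr do rewrite integral_indic//.
rewrite sum_fine//.
by move=> W _; rewrite fin_num_measure//; exact: measurableI.
Qed.

End continued_fraction_measure.

Section uniqueness_and_integral.
Context {R : realType}.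
Variables (lambda p : R).
Hypotheses (h : 2 <= lambda) (p0 : 0 < p) (p1 : p <= 1).
Implicit Types (mu nu : probability (measurableTypeR R) R).

(** Compare cell by cell. A cell that meets the half-line is contained in the
    shifted one, being no longer than the shift, and the two measures give it the
    same mass. *)
Lemma is_mu_ray_le_shift mu nu t m : is_mu lambda p mu -> is_mu lambda p nu ->
  fine (nu [set` `[t, +oo[]) <= fine (mu [set` `[t - m.+1%:R^-1, +oo[]).
Proof.
move=> muP nuP.
have mray t' : measurable ([set` `[t', +oo[] : set (measurableTypeR R)).
  exact: measurable_itv.
(* Words of length [m + 2] are used because the diameter bound counts the
   letters after the first one. *)
rewrite (words_prob h p0 p1 nuP m.+2)// (words_prob h p0 p1 muP m.+2)//.
rewrite big_seq [leRHS]big_seq; apply: ler_sum => W /size_words sW.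
have mW : measurable (cell lambda W : set (measurableTypeR R)).
  exact: cell_measurable.
have [[x [tx xW]]|noW] := pselect (exists x, [set` `[t, +oo[] x /\ cell lambda W x).
  have -> : [set` `[t - m.+1%:R^-1, +oo[] `&` cell lambda W = cell lambda W.
    apply/setIidr => y yW; move: tx; rewrite /= !in_itv /= !andbT => tx.
    case: W sW xW yW {mW} => [//|c X] [sX] xW yW.
    have := cell_diam h xW yW; rewrite sX -ler_pdivlMl ?ltr0n// mulr1 => d.
    by rewrite lerBlDr (le_trans tx)// -lerBlDl (le_trans (ler_norm _)).
  rewrite (prob_cell muP) -(prob_cell nuP).
  by apply: fine_prob_le => //; exact: measurableI.
have -> : [set` `[t, +oo[] `&` cell lambda W = set0.
  by apply/seteqP; split=> // x [? ?]; apply: noW; exists x.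
by rewrite measure0 fine_ge0.
Qed.

Lemma is_mu_ray_le mu nu t : is_mu lambda p mu -> is_mu lambda p nu ->
  fine (nu [set` `[t, +oo[]) <= fine (mu [set` `[t, +oo[]).
Proof.
move=> muP nuP.
pose F n : set (measurableTypeR R) := [set` `[t - n.+1%:R^-1, +oo[].
have mF n : measurable (F n) by exact: measurable_itv.
have FE : \bigcap_n F n = [set` `[t, +oo[].
  apply/seteqP; split=> x; last first.
    move=> xt n _; move: xt; rewrite /F /= !in_itv /= !andbT; apply: le_trans.
    by rewrite gerBl invr_ge0.
  move=> Fx; rewrite /= in_itv /= andbT; apply/ler_addgt0Pr => e e0; pose e' := PosNum e0.
  near \oo => n.
  have := Fx n I; rewrite /F /= in_itv /= andbT lerBlDr => /le_trans; apply.
  by rewrite lerD2l ltW//; near: n; exact: (near_infty_natSinv_lt e').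
have : mu (F n) @[n --> \oo] --> mu (\bigcap_n F n).
  apply: nonincreasing_cvg_mu => //.
  - by rewrite -ge0_fin_numE// fin_num_measure.
  - exact: bigcapT_measurable.
  - move=> m n mn; apply/subsetPset; apply: subset_itvr.
    by rewrite bnd_simp lerD2l lerN2 lef_pV2 ?posrE// ler_nat.
have mray : measurable ([set` `[t, +oo[] : set (measurableTypeR R)).
  exact: measurable_itv.
rewrite FE -[X in _ --> X](fineK (fin_num_measure mu _ mray)) => /fine_cvg cF.
rewrite -(cvg_lim _ cF)//; apply: limr_ge; first by apply/cvg_ex; eexists; exact: cF.
by apply: nearW => n; exact: is_mu_ray_le_shift.
Unshelve. all: by end_near. Qed.

Lemma is_mu_unique mu nu : is_mu lambda p mu -> is_mu lambda p nu ->
  forall A : set (measurableTypeR R), measurable A -> nu A = mu A.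
Proof.
move=> muP nuP.
apply: (@measure_unique _ R (measurableTypeR R) (@RGenCInfty.G R)
  (fun n => [set` `[(- n%:R : R), +oo[])).
- exact: RGenCInfty.measurableE.
- move=> _ _ [x ->] [y ->]; exists (Num.max x y).
  by apply/seteqP; split=> z /=; rewrite !in_itv /= !andbT ge_max => /andP.
- by move=> n; exists (- n%:R).
- apply/seteqP; split=> // x _; exists (Num.truncn `|x|).+1 => //=.
  rewrite in_itv /= andbT; have := truncnS_gt `|x|.
  by have := ler_norm (- x); rewrite normrN; lra.
- move=> _ [t ->].
  have mray : measurable ([set` `[t, +oo[] : set (measurableTypeR R)).
    exact: measurable_itv.
  rewrite -[LHS]fineK ?fin_num_measure// -[RHS]fineK ?fin_num_measure//.
  by congr (_%:E); apply: le_anti; rewrite !is_mu_ray_le.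
- by move=> n; rewrite -ge0_fin_numE// fin_num_measure//; exact: measurable_itv.
Qed.

End uniqueness_and_integral.

(** * Existence, by coding the unit interval *)

Section existence.
Context {R : realType}.
Variables (lambda p : R).
Hypotheses (h : 2 <= lambda) (p0 : 0 < p) (p1 : p <= 1).
Local Notation leb := (@lebesgue_measure R).
Local Notation mR := (measurableTypeR R).

(** Both sides are measures in [D] that agree on half-open intervals. *)
Lemma lebesgue_measure_affine (a b : R) (D : set mR) : 0 < a ->
  measurable D -> leb ((fun u => (u - b) / a) @^-1` D) = (a%:E * leb D)%E.
Proof.
move=> a0 mD; pose g : mR -> mR := fun u => (u - b) / a.
have mg : measurable_fun [set: mR] g.
  by apply: measurable_funM => //; exact: measurable_funB.
have ai0 : 0 <= a^-1 by rewrite invr_ge0 ltW.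
pose nu := measure_function_pushforward__canonical__measure_function_Measure
  leb mg.
pose mu : {measure set mR -> \bar R} := mscale (NngNum ai0) nu.
have muE A : mu A = ((a^-1)%:E * leb (g @^-1` A))%E by [].
have /(_ D mD) -> : forall A, measurable A -> leb A = mu A.
  apply: lebesgue_measure_unique => _ [[s t] _ <-]; rewrite muE.
  have -> : g @^-1` `]s, t] = [set` `](a * s + b), (a * t + b)]].
    apply/seteqP; split=> u; rewrite /= !in_itv /= /g ltr_pdivlMr// ler_pdivrMr//;
      by rewrite ltrBrDr lerBlDr ![a * _]mulrC.
  rewrite !lebesgue_measure_itv /= !lte_fin ltrD2r ltr_pM2l//.
  case: ifP => _; last by rewrite mule0.
  rewrite -!EFinD -EFinM; congr (_%:E); field.
  by rewrite gt_eqF.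
rewrite muE muleA -EFinM divff ?gt_eqF// mul1e.
by [].
Qed.


(** [digit] and [shift_digits] give the expansion of [u] adapted to the biased
    coin: under Lebesgue measure on [0 <= u < 1] the digits are independent and equal
    to the letter [R] with probability [p]. *)
Definition digit (u : R) : bool := 1 - p <= u.

Definition shift_digits (u : R) : R :=
  if digit u then (u - (1 - p)) / p else u / (1 - p).

(** The first digit is the outermost map. This order makes the compositions
    converge, and makes [coding] commute with cutting off a digit. *)
Fixpoint approx n (u : R) : R :=
  if n is n'.+1 then mobius lambda (digit u) (approx n' (shift_digits u))
  else B_ lambda.

Definition coding (u : R) : R := limn (approx ^~ u).

Lemma approx_ge n u : B_ lambda <= approx n u.
Proof.
by elim: n u => [//|n IH] u /=; case/andP: (mobius_bound (digit u) h (IH (shift_digits u))).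
Qed.

Lemma approx_mobius_word n u : exists2 W, size W = n &
  forall k, approx (n + k) u = mobius_word lambda W (approx k (iter n shift_digits u)).
Proof.
elim: n u => [|n IH] u; first by exists [::].
have [W sW WE] := IH (shift_digits u).
exists (rcons W (digit u)) => [|k]; first by rewrite size_rcons sW.
by rewrite addSn /= WE /mobius_word -cats1 foldl_cat /= -iterSr.
Qed.

Lemma approx_dist n k u : n%:R * `|approx n u - approx (n + k) u| <= 1.
Proof.
have [W sW WE] := approx_mobius_word n u.
rewrite WE -{2}(addn0 n) WE -[in n%:R]sW; apply: mobius_word_contract => //.
exact: approx_ge.
Qed.

Lemma cvg_approx u : approx n u @[n --> \oo] --> coding u.
Proof.
apply/cauchy_cvgP/cauchy_exP => e e0; pose e' := PosNum e0.
near \oo => n.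
exists (approx n.+1 u); exists n.+1 => // m /= nm.
rewrite /ball /= -(subnKC nm).
have := approx_dist n.+1 (m - n.+1) u.
rewrite -ler_pdivlMl// mulr1 => /le_lt_trans; apply.
by near: n; exact: (near_infty_natSinv_lt e').
Unshelve. all: by end_near. Qed.

Lemma coding_ge u : B_ lambda <= coding u.
Proof.
apply: limr_ge; first by apply/cvg_ex; eexists; exact: cvg_approx.
by apply: nearW => n; exact: approx_ge.
Qed.

Lemma coding_shift u : coding u = mobius lambda (digit u) (coding (shift_digits u)).
Proof.
have c1 : approx n.+1 u @[n --> \oo] --> coding u.
  by have := @cvg_approx u; rewrite -cvg_shiftS.
apply: (cvg_unique _ c1) => //=.
have T0 : coding (shift_digits u) != 0.
  by rewrite gt_eqF// (lt_le_trans (B_gt0 h))// coding_ge.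
have cV : (approx n (shift_digits u))^-1 @[n --> \oo] -->
    (coding (shift_digits u))^-1 by apply: cvgV => //; exact: cvg_approx.
rewrite /mobius; case: (digit u).
  by apply: cvgD; [exact: cvg_cst|exact: cV].
by apply: cvgB; [exact: cvg_cst|exact: cV].
Qed.

Lemma coding_bound u : B_ lambda <= coding u <= lambda + (B_ lambda)^-1.
Proof. by rewrite coding_shift; apply: mobius_bound => //; exact: coding_ge. Qed.

Lemma digit_measurable : measurable_fun [set: R] digit.
Proof. exact: measurable_fun_ler. Qed.

Lemma shift_digits_measurable : measurable_fun [set: R] shift_digits.
Proof.
apply: measurable_fun_ifT; first exact: digit_measurable.
  by apply: measurable_funM => //; exact: measurable_funB.
exact: measurable_funM.
Qed.

Lemma approx_measurable n : measurable_fun [set: R] (approx n).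
Proof.
elim: n => [|n IH]; first exact: measurable_cst.
rewrite [approx _](_ : _ = fun u => if digit u
  then mobius lambda true (approx n (shift_digits u))
  else mobius lambda false (approx n (shift_digits u))); last first.
  by apply/funext => u /=; case: (digit u).
apply: measurable_fun_ifT; first exact: digit_measurable.
all: apply: measurableT_comp; first exact: mobius_measurable.
all: by apply: measurableT_comp => //; exact: shift_digits_measurable.
Qed.

Lemma coding_measurable : measurable_fun [set: mR] (coding : mR -> mR).
Proof.
apply: (@measurable_fun_cvg _ _ _ _ approx) => // [n|u _].
  exact: approx_measurable.
exact: cvg_approx.
Qed.


Let U : set mR := [set` `[0, 1[].
Let mU : measurable U. Proof. exact: measurable_itv. Qed.
Let lebU : leb U = 1%E.
Proof. by rewrite lebesgue_measure_itv /= lte_fin ltr01 sube0. Qed.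

(** Each of the two pieces of [0 <= u < 1] is an affine copy of the whole, of ratio
    [letter_prob p c]. For [p = 1] the piece of the letter [L] is empty. *)
Lemma leb_digit_shift c (C : set mR) : measurable C ->
  leb ([set u | digit u = c /\ C (shift_digits u)] `&` U) =
  ((letter_prob p c)%:E * leb (C `&` U))%E.
Proof.
move=> mC; have mCU : measurable (C `&` U) by exact: measurableI.
case: c => /=.
  rewrite /letter_prob -(lebesgue_measure_affine (1 - p) p0 mCU).
  congr (leb _); apply/seteqP; split=> u.
    move=> [[du]]; rewrite /shift_digits du => Cu; rewrite /U /= !in_itv /=.
    move: du; rewrite /digit => du /andP[u0 u1]; split=> //.
    by rewrite divr_ge0 ?subr_ge0 ?(ltW p0)//= ltr_pdivrMr// mul1r ltrBlDr addrC subrK.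
  move=> [Cu]; rewrite /U /= !in_itv /= => /andP[].
  rewrite ler_pdivlMr// mul0r ltr_pdivrMr// mul1r subr_ge0 => du u1.
  have dE : digit u by [].
  rewrite /shift_digits dE; split=> //; apply/andP; split.
    by rewrite (le_trans _ du)// subr_ge0.
  by move: u1; rewrite ltrBlDr addrC subrK.
have [p1'|p1'] := eqVneq p 1.
  rewrite /letter_prob p1' subrr mul0e [X in leb X](_ : _ = set0) ?measure0//.
  apply/seteqP; split=> // u [[+ _]]; rewrite /U /= in_itv /= => + /andP[u0 _].
  by rewrite /digit p1' subrr u0.
have q0 : 0 < 1 - p by rewrite subr_gt0 lt_neqAle p1'.
rewrite /letter_prob -(lebesgue_measure_affine 0 q0 mCU).
congr (leb _); apply/seteqP; split=> u.
  move=> [[du]]; rewrite /shift_digits du => Cu; rewrite /U /= !in_itv /= subr0.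
  move: du; rewrite /digit => /negbT; rewrite -ltNge => du /andP[u0 u1].
  by split=> //; rewrite divr_ge0 ?(ltW q0)//= ltr_pdivrMr// mul1r.
move=> [Cu]; rewrite /U /= !in_itv /= subr0 => /andP[].
rewrite ler_pdivlMr// mul0r ltr_pdivrMr// mul1r => u0 du.
have dE : digit u = false by apply/negbTE; rewrite -ltNge.
rewrite /shift_digits dE -[u in C (u / _)]subr0; split=> //; rewrite u0 /=.
by rewrite (lt_le_trans du)// lerBlDr lerDl ltW.
Qed.

Lemma coding_law_exists : exists mu : probability mR R,
  forall A, measurable A -> mu A = leb (coding @^-1` A `&` U).
Proof.
pose m : {measure set mR -> \bar R} :=
  measure_function_pushforward__canonical__measure_function_Measure
    (mrestr leb mU) coding_measurable.
have m1 : m [set: mR] = 1%E.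
  by rewrite /= /pushforward /mrestr preimage_setT setTI lebU.
pose mu : probability mR R :=
  HB.pack (Measure.sort m) (Measure_isProbability.Build _ _ _ m m1).
by exists mu.
Qed.


(** Points obtained with different last letters lie on different sides of
    [lambda]. *)
Lemma cell_rcons W c d y : B_ lambda <= y ->
  cell lambda (rcons W d) (mobius lambda c y) <-> c = d /\ cell lambda W y.
Proof.
move=> By; have y0 : 0 < y by exact: lt_le_trans (B_gt0 h) By.
have yl : mobius lambda c y != lambda.
  by rewrite /mobius; case: c; rewrite -subr_eq0 addrAC subrr add0r ?oppr_eq0
    invr_eq0 gt_eqF.
rewrite /cell /I_ -cats1 foldl_cat /= -/(I_ lambda W); split; last first.
  by move=> [-> Wy]; exists y%:E => //; rewrite f_EFin ?gt_eqF.
move=> [[z| |] Wz]; last 2 first.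
- by rewrite f_pinfty => -[] /esym/eqP; rewrite (negbTE yl).
- move: Wz; case: W => [|e X]; last by rewrite I_cons// => -[].
  by rewrite /I_ /=.
have Bz : B_ lambda <= z := @cell_ge _ lambda W z h Wz.
have z0 : 0 < z by exact: lt_le_trans (B_gt0 h) Bz.
rewrite f_EFin ?gt_eqF// => -[fzy].
have dc : d = c.
  move: fzy; case: d; case: c {yl} => // fzy.
  - by have := mobius_R_gt lambda z0; rewrite fzy ltNge ltW// mobius_L_lt.
  - by have := mobius_R_gt lambda y0; rewrite -fzy ltNge ltW// mobius_L_lt.
by subst d; move/mobius_inj: fzy => <-.
Qed.

(** Induction on the last letter of the word, which is the first digit. *)
Lemma is_mu_exists : exists mu : probability mR R, is_mu lambda p mu.
Proof.
have [mu muE] := coding_law_exists.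
have muT A : measurable A -> (forall u, A (coding u)) -> mu A = 1%E.
  move=> mA AT; rewrite muE// (_ : coding @^-1` A = setT) ?setTI ?lebU//.
  by apply/seteqP; split=> // u _; exact: AT.
exists mu; split.
  apply: muT => [|u]; first exact: measurable_itv.
  by rewrite /= in_itv /=; exact: coding_bound.
move=> W _; rewrite word_probE -/(cell lambda W).
have mc V : measurable (cell lambda V : set mR) by exact: cell_measurable.
elim/last_ind: W => [|W c IH].
  rewrite /word_prob big_nil; apply: muT => [|u]; first exact: mc.
  by rewrite cell_nil /= in_itv /= andbT; exact: coding_ge.
have -> : word_prob p (rcons W c) = letter_prob p c * word_prob p W.
  by rewrite mulrC /word_prob -cats1 big_cat big_seq1.
rewrite EFinM -IH.
rewrite !muE// -leb_digit_shift; last first.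
  by rewrite -[X in measurable X]setTI; exact: coding_measurable.
congr (leb (_ `&` _)); apply/seteqP; split=> u /=;
  by rewrite [coding u]coding_shift cell_rcons//; exact: coding_ge.
Qed.

End existence.

(** * The mean of the logarithm *)

Section log_integral.
Context {R : realType}.

Lemma ln_dist_le (x y : R) : 1 <= x -> 1 <= y -> `|ln x - ln y| <= `|x - y|.
Proof.
wlog yx : x y / y <= x.
  by move=> H x1 y1; have [/H|/ltW /H] := leP y x; [|rewrite !(distrC _ y)
    !(distrC _ (ln y))]; apply.
move=> x1 y1; have x0 : 0 < x by lra.
have y0 : 0 < y by lra.
rewrite !ger0_norm ?subr_ge0 ?ler_ln ?posrE//.
have xE : x = y * (1 + (x - y) / y) by field; rewrite gt_eqF.
have t0 : 0 <= (x - y) / y by apply: divr_ge0; lra.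
have ty : (x - y) / y <= x - y by rewrite ler_pdivrMr//; nra.
rewrite [in ln x]xE lnM ?posrE//; last by lra.
by rewrite addrC addKr (le_trans (le_ln1Dx _))//; lra.
Qed.

Variables (lambda p : R) (mu : probability (measurableTypeR R) R).
Hypotheses (h : 2 <= lambda) (p0 : 0 < p) (p1 : p <= 1).
Hypothesis muP : is_mu lambda p mu.

Let l1 : 1 < lambda.
Proof. by apply: lt_le_trans h; rewrite ltr1n. Qed.

Let K : set (measurableTypeR R) := [set` `[B_ lambda, lambda + (B_ lambda)^-1]].
Let H : set (measurableTypeR R) := [set` `[B_ lambda, +oo[].
Let D : set (measurableTypeR R) := [set` `]0, +oo[].
Let lnE : measurableTypeR R -> \bar R := fun x => (ln x)%:E.

Let mK : measurable K. Proof. exact: measurable_itv. Qed.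
Let mH : measurable H. Proof. exact: measurable_itv. Qed.
Let mD : measurable D. Proof. exact: measurable_itv. Qed.
Let mlnE : measurable_fun [set: measurableTypeR R] lnE.
Proof.
rewrite (_ : lnE = EFin \o (@ln R : measurableTypeR R -> R))//.
apply/measurable_EFinP; exact: measurable_ln.
Qed.

Let B0 : 0 < B_ lambda. Proof. exact: B_gt0. Qed.
Let B1 : 1 <= B_ lambda. Proof. exact: B_ge1. Qed.

Let muK : mu K = 1%E. Proof. exact: muP.1. Qed.

Let muCK : mu (~` K) = 0%E.
Proof. by rewrite probability_setC// muK subee. Qed.

Let DK : D `\` ~` K = K.
Proof.
rewrite setDE setCK; apply/setIidr => x.
by rewrite /D /K /= !in_itv /= andbT => /andP[+ _]; exact: lt_le_trans.
Qed.

Let HK : H `\` ~` K = K.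
Proof. by rewrite setDE setCK; apply/setIidr; apply: subset_itvl. Qed.

Lemma ln_EFin_ge0 x : B_ lambda <= x -> (0 <= (ln x)%:E)%E.
Proof. by move=> Bx; rewrite lee_fin ln_ge0// (le_trans B1). Qed.

(** The logarithm is bounded on the interval that carries the measure. *)
Lemma ln_integrable : mu.-integrable D lnE.
Proof.
apply/integrableP; split; first exact: measurable_funTS.
rewrite (@ge0_negligible_integral _ _ _ mu D (~` K))//; last 2 first.
- exact: measurableC.
- by apply: measurableT_comp => //; exact: measurable_funTS.
rewrite DK; apply: (@le_lt_trans _ _
  (\int[mu]_(x in K) cst (ln (lambda + (B_ lambda)^-1))%:E x)%E).
  apply: ge0_le_integral => //.
  - by apply: measurableT_comp => //; exact: measurable_funTS.
  - move=> x; rewrite /K /= in_itv /= => /andP[Bx xK].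
    have x0 : 0 < x by exact: lt_le_trans Bx.
    rewrite lee_fin ger0_norm ?ln_ge0 ?(le_trans B1)// ler_ln ?posrE//.
    exact: lt_le_trans xK.
by rewrite integral_cst// [X in (_ * X)%E]muK mule1 ltey.
Qed.

Lemma EFin_log_integral :
  (\int[mu]_(x in D) ln x)%:E = (\int[mu]_(x in H) (ln x)%:E)%E.
Proof.
rewrite /Rintegral fineK; last exact: integrable_fin_num ln_integrable.
rewrite (@negligible_integral _ _ _ mu D (~` K))//; last 2 first.
- exact: measurableC.
- exact: ln_integrable.
rewrite DK (@ge0_negligible_integral _ _ _ mu H (~` K))//; last 3 first.
- exact: measurableC.
- exact: measurable_funTS.
- by move=> x; rewrite /H /= in_itv /= andbT; exact: ln_EFin_ge0.
by rewrite HK.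
Qed.

Let mcell W : measurable (cell lambda W : set (measurableTypeR R)).
Proof. exact: cell_measurable. Qed.

Let integral_cell_cst W r :
  (\int[mu]_(x in cell lambda W) cst r%:E x)%E = (r * word_prob p W)%:E.
Proof.
rewrite integral_cst// EFinM; congr (_ * _)%E.
by rewrite -(prob_cell muP) fineK ?fin_num_measure.
Qed.

(** Already the interval of the letter [R], which has mass [p], contributes at
    least [p * ln lambda]. *)
Lemma log_integral_gt0 : 0 < \int[mu]_(x in D) ln x.
Proof.
rewrite -lte_fin EFin_log_integral.
apply: (@lt_le_trans _ _ (\int[mu]_(x in cell lambda [:: true]) (ln x)%:E)%E);
    last first.
  apply: ge0_subset_integral => //; first exact: measurable_funTS.
    by move=> x; rewrite /H /= in_itv /= andbT; exact: ln_EFin_ge0.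
  by move=> x /(cell_ge h); rewrite /H /= in_itv /= andbT.
apply: (@lt_le_trans _ _
    (\int[mu]_(x in cell lambda [:: true]) cst (ln lambda)%:E x)%E).
  rewrite integral_cell_cst /word_prob big_seq1 /letter_prob lte_fin mulr_gt0//.
  exact: ln_gt0.
apply: ge0_le_integral => //.
- by move=> x _; rewrite lee_fin ln_ge0// ltW.
- exact: measurable_funTS.
- move=> x; rewrite cell_cons// image_id /= in_itv /= => /andP[lx _].
  have l0 : 0 < lambda by exact: lt_trans l1.
  by rewrite lee_fin ler_ln ?posrE// (lt_le_trans l0).
Qed.

(** Split the integral over the cells of length [m + 1]. On each of them the
    logarithm is within [1 / m] of its value at the image of [B] under the last
    [m] letters, and the two cells that share these letters have total mass
    [word_prob p X]. *)
Lemma log_integral_words m : m%:R *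
  `|\int[mu]_(x in D) ln x -
    \sum_(X <- words m) word_prob p X * ln (mobius_word lambda X (B_ lambda))| <= 1.
Proof.
case: m => [|m]; first by rewrite mul0r.
set e := (m.+1%:R)^-1 : R.
have e0 : 0 < e by rewrite invr_gt0.
rewrite -ler_pdivlMl// mulr1 -/e.
have key c X : size X = m.+1 ->
    let I := (\int[mu]_(x in cell lambda (c :: X)) (ln x)%:E)%E in
    let w := word_prob p (c :: X) in let g := ln (mobius_word lambda X (B_ lambda)) in
    [/\ I \is a fin_num, fine I <= (g + e) * w & g * w <= fine I + e * w].
  move=> sX I w g.
  have g0 : 0 <= g by rewrite ln_ge0// (le_trans B1)// mobius_word_ge.
  have lnc x : cell lambda (c :: X) x -> `|ln x - g| <= e.
    move=> xc; have Bx := cell_ge h xc.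
    apply: le_trans (ln_dist_le _ _) _.
    - exact: le_trans Bx.
    - by rewrite (le_trans B1)// mobius_word_ge.
    move: xc; rewrite cell_cons// => -[y /(first_itv_bound h) /andP[By _] <-].
    rewrite -[e]mulr1 ler_pdivlMl// -sX; exact: mobius_word_contract.
  have ln0 x : cell lambda (c :: X) x -> (0 <= (ln x)%:E)%E.
    by move=> /(cell_ge h); exact: ln_EFin_ge0.
  have I1 : (I <= ((g + e) * w)%:E)%E.
    rewrite -integral_cell_cst; apply: ge0_le_integral => //; first exact: measurable_funTS.
    by move=> x /lnc; rewrite lee_fin ler_norml => /andP[_]; rewrite lerBlDl.
  have I0 : (0 <= I)%E by exact: integral_ge0.
  have If : I \is a fin_num.
    by rewrite ge0_fin_numE// (le_lt_trans I1)// ltey.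
  split=> //; first by rewrite -lee_fin fineK.
  rewrite -lee_fin EFinD fineK// -!integral_cell_cst -ge0_integralD//; last 2 first.
  - exact: measurable_funTS.
  - by move=> x _; rewrite lee_fin ltW.
  apply: ge0_le_integral => //.
    by apply: emeasurable_funD => //; exact: measurable_funTS.
  move=> x /lnc; rewrite -EFinD lee_fin ler_norml => /andP[+ _].
  by rewrite lerBrDl lerBlDr addrC.
have -> : \int[mu]_(x in D) ln x = \sum_(X <- words m.+1)
   (fine (\int[mu]_(x in cell lambda (true :: X)) (ln x)%:E)%E +
    fine (\int[mu]_(x in cell lambda (false :: X)) (ln x)%:E)%E).
  apply: EFin_inj; rewrite EFin_log_integral.
  rewrite (@words_integral _ _ _ _ h p0 p1 muP m.+2)//; last exact: ln_EFin_ge0.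
  rewrite big_wordsS -sumEFin big_seq [RHS]big_seq; apply: eq_bigr => X.
  move=> /size_words sX; rewrite EFinD.
  by rewrite !fineK//; [case: (key false X sX)|case: (key true X sX)].
rewrite -sumrB (le_trans (ler_norm_sum _ _ _))//.
rewrite -[leRHS]mulr1 -(sum_word_prob p m.+1) mulr_sumr.
rewrite big_seq [leRHS]big_seq; apply: ler_sum => X /size_words sX.
have [_ a1 a2] := key true X sX; have [_ b1 b2] := key false X sX.
move: a1 a2 b1 b2; rewrite !word_prob_cons /letter_prob /= ler_norml.
move: (fine _) (fine _) (word_prob p X) (ln _) => I J w g *.
by apply/andP; split; lra.
Qed.

End log_integral.

(** * A strong law for events that are independent at distance *)

Section bounded_variables.
Context d (T : measurableType d) (R : realType) (P : probability T R).
Implicit Types f g : T -> R.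

(** A class of integrable functions that is stable under products, for moment
    computations. *)
Definition bounded_mfun f :=
  measurable_fun [set: T] f /\ exists M, forall x, `|f x| <= M.

Lemma bounded_mfun_cst c : bounded_mfun (fun=> c).
Proof. by split; [exact: measurable_cst|exists `|c|]. Qed.

Lemma bounded_mfun_indic (A : set T) : measurable A -> bounded_mfun (\1_A).
Proof.
move=> mA; split; first exact: measurable_indic.
by exists 1 => x; rewrite indicE; case: (x \in A); rewrite ?normr1 ?normr0.
Qed.

Lemma bounded_mfunD f g : bounded_mfun f -> bounded_mfun g ->
  bounded_mfun (fun x => f x + g x).
Proof.
move=> [mf [M fM]] [mg [N gN]]; split; first exact: measurable_funD.
by exists (M + N) => x; rewrite (le_trans (ler_normD _ _))// lerD.
Qed.

Lemma bounded_mfunM f g : bounded_mfun f -> bounded_mfun g ->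
  bounded_mfun (fun x => f x * g x).
Proof.
move=> [mf [M fM]] [mg [N gN]]; split; first exact: measurable_funM.
by exists (M * N) => x; rewrite normrM ler_pM.
Qed.

Lemma bounded_mfunZ c f : bounded_mfun f -> bounded_mfun (fun x => c * f x).
Proof. by move=> bf; apply: bounded_mfunM => //; exact: bounded_mfun_cst. Qed.

Lemma bounded_mfun_sum n (f : nat -> T -> R) : (forall i, bounded_mfun (f i)) ->
  bounded_mfun (fun x => \sum_(i < n) f i x).
Proof.
move=> bf; elim: n => [|n IH].
  by under eq_fun do rewrite big_ord0; exact: bounded_mfun_cst.
by under eq_fun do rewrite big_ord_recr /=; exact: bounded_mfunD.
Qed.

Lemma bounded_mfun_integrable f : bounded_mfun f ->
  P.-integrable [set: T] (EFin \o f).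
Proof.
move=> [mf [M fM]]; apply: (@le_integrable _ _ _ P _ measurableT _ (EFin \o cst M)) => //.
- exact/measurable_EFinP.
- by move=> x _ /=; rewrite lee_fin (le_trans (fM x))// ler_norm.
- exact: finite_measure_integrable_cst.
Qed.

Local Notation E f := (\int[P]_x f x).

Lemma meanD f g : bounded_mfun f -> bounded_mfun g ->
  E (fun x => f x + g x) = E f + E g.
Proof. by move=> bf bg; rewrite RintegralD//; exact: bounded_mfun_integrable. Qed.

Lemma meanZ c f : bounded_mfun f -> E (fun x => c * f x) = c * E f.
Proof. by move=> bf; rewrite RintegralZl//; exact: bounded_mfun_integrable. Qed.

Lemma mean_cst c : E (fun=> c) = c.
Proof. by rewrite Rintegral_cst// [X in fine X]probability_setT mulr1. Qed.

Lemma mean_indic (A : set T) : measurable A -> E (\1_A) = fine (P A).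
Proof. by move=> mA; rewrite /Rintegral integral_indic// setIT. Qed.

End bounded_variables.

Lemma nat_sqrt n : exists s, (s * s <= n < s.+1 * s.+1)%N.
Proof.
elim: n => [|n [s /andP[sn ns]]]; first by exists 0%N.
have [e|ne] := eqVneq n.+1 (s.+1 * s.+1)%N.
  by exists s.+1; rewrite e leqnn /= ltn_mul.
by exists s; rewrite (leq_trans sn)//= ltn_neqAle ne.
Qed.

Lemma sum_inv_sqr_le (R : realType) n :
  \sum_(k < n) ((k.+1 * k.+1)%N%:R)^-1 <= 2 :> R.
Proof.
suff : \sum_(k < n) ((k.+1 * k.+1)%N%:R)^-1 <= 2 - 2 / n.+1%:R :> R.
  by move=> /le_trans; apply; rewrite gerBl divr_ge0.
elim: n => [|n IH]; first by rewrite big_ord0 divr1 subrr.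
rewrite big_ord_recr /= (le_trans (lerD IH (lexx _)))//.
have n0 : 0 <= n%:R :> R by [].
rewrite -subr_ge0 natrM -[in n.+2%:R]natr1 -[in n.+1%:R]natr1.
move: (n%:R) n0 => t t0.
have -> : 2 - 2 / (t + 1 + 1) - (2 - 2 / (t + 1) + ((t + 1) * (t + 1))^-1) =
    t / ((t + 1) * (t + 1) * (t + 1 + 1)).
  by field; apply/andP; split; apply: lt0r_neq0; lra.
by apply: divr_ge0 => //; rewrite !mulr_ge0//; lra.
Qed.

(** Between two consecutive squares [s ^ 2 <= n < (s + 1) ^ 2] the sequence moves
    by at most [2 s], which is negligible with respect to [n]. *)
Lemma cvg_of_squares (R : realType) (x : nat -> R) :
  (forall n, `|x n.+1 - x n| <= 1) ->
  (x (k.+1 * k.+1)%N / (k.+1 * k.+1)%N%:R) ^+ 2 @[k --> \oo] --> (0 : R) ->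
  x n / n%:R @[n --> \oo] --> (0 : R).
Proof.
move=> x1 xsq.
have xD n j : `|x (n + j)%N - x n| <= j%:R.
  elim: j => [|j IH]; first by rewrite addn0 subrr normr0.
  rewrite addnS -(subrKA (x (n + j)%N)) (le_trans (ler_normD _ _))//.
  by rewrite -natr1 addrC lerD.
apply/cvgr0Pnorm_le => e e0.
have e2 : 0 < (e / 2) ^+ 2 by rewrite exprn_gt0// divr_gt0.
have /cvgr0Pnorm_le /(_ _ e2) [K1 _ hK1] := xsq.
pose K2 := (Num.truncn (4 / e)).+1.
pose K := maxn K1 K2.
exists (K.+1 * K.+1)%N => // n /= Kn.
have [s /andP[sn ns]] := nat_sqrt n.
have Ks : (K < s)%N.
  rewrite ltnNge; apply/negP => sK.
  by move: (leq_trans ns (leq_mul (sK : s < K.+1)%N (sK : s < K.+1)%N)); rewrite ltnNge Kn.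
case: s Ks sn ns => [//|k] Kk sn ns.
have k1 : (K1 <= k)%N by rewrite (leq_trans (leq_maxl K1 K2)).
have k2 : (K2 <= k)%N by rewrite (leq_trans (leq_maxr K1 K2)).
have n0 : 0 < n%:R :> R by rewrite ltr0n (leq_trans _ sn).
set N := (k.+1 * k.+1)%N in sn *.
have N0 : 0 < N%:R :> R by rewrite ltr0n.
have xN : `|x N| <= e / 2 * N%:R.
  have := hK1 k k1; rewrite /= -/N normrX ler_pXn2r ?nnegrE//; last first.
    by apply: divr_ge0 => //; exact: ltW.
  by rewrite normf_div [`|N%:R|]ger0_norm// ler_pdivrMr.
have kR : 4 / e <= k.+1%:R.
  rewrite (le_trans (ltW (truncnS_gt _)))// ler_nat.
  by rewrite (leq_trans k2).
have k4 : 4 <= e * k.+1%:R by rewrite mulrC -ler_pdivrMr.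
have nN : (n - N <= k.+1.*2)%N.
  by rewrite leq_subLR -ltnS (leq_trans ns)// /N -addnn !mulSn !mulnS; lia.
have xn : `|x n| <= `|x N| + (n - N)%N%:R.
  rewrite -{1}(subnKC sn) -lerBlDl (le_trans (lerB_dist _ _))//.
rewrite normf_div [`|n%:R|]ger0_norm// ler_pdivrMr// (le_trans xn)//.
have nR : N%:R <= n%:R :> R by rewrite ler_nat.
have n2 : (n - N)%N%:R <= 2 * k.+1%:R :> R by rewrite -natrM ler_nat mul2n.
have NE : N%:R = k.+1%:R * k.+1%:R :> R by rewrite natrM.
have k0 : 0 < k.+1%:R :> R by rewrite ltr0n.
have : 2 * k.+1%:R <= e / 2 * N%:R by rewrite NE; nra.
have : e * N%:R <= e * n%:R by rewrite ler_pM2l.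
lra.
Qed.

Section frequency.
Context d (T : measurableType d) (R : realType) (P : probability T R).
Variables (A : nat -> set T) (q : R) (m : nat).
Hypothesis mA : forall i, measurable (A i).
Hypothesis PA : forall i, fine (P (A i)) = q.
Hypothesis PAA : forall i j, (i + m <= j)%N -> fine (P (A i `&` A j)) = q * q.

Let Y i x := \1_(A i) x - q.
Let X n x := \sum_(i < n) Y i x.

Let q01 : 0 <= q <= 1.
Proof.
rewrite -(PA 0) fine_ge0//= -lee_fin fineK ?fin_num_measure//.
exact: probability_le1.
Qed.

Let Y1 i x : `|Y i x| <= 1.
Proof.
rewrite /Y indicE; move: q01; case: (_ \in _) => /= /andP[q0 q1];
by rewrite ler_norml; apply/andP; split; lra.
Qed.

Let bY i : bounded_mfun (Y i).
Proof.
by apply: bounded_mfunD; [exact: bounded_mfun_indic|exact: bounded_mfun_cst].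
Qed.

Let bX n : bounded_mfun (X n).
Proof. exact: bounded_mfun_sum. Qed.

Lemma centered_cov i j : \int[P]_x (Y i x * Y j x) = fine (P (A i `&` A j)) - q * q.
Proof.
have bA k : bounded_mfun (\1_(A k) : T -> R) by exact: bounded_mfun_indic.
have mI : measurable (A i `&` A j) by exact: measurableI.
have bI : bounded_mfun (\1_(A i `&` A j) : T -> R) by exact: bounded_mfun_indic.
transitivity (\int[P]_x (\1_(A i `&` A j) x +
    (- q * \1_(A i) x + (- q * \1_(A j) x + q * q)) : R)).
  by apply: eq_Rintegral => x _; rewrite /Y indicI /=; ring.
rewrite !meanD//; do ?[exact: bounded_mfunZ | exact: bounded_mfun_cst
  | apply: bounded_mfunD].
have EA k : \int[P]_x \1_(A k) x = q by rewrite -(PA k) -mean_indic.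
have EI : \int[P]_x \1_(A i `&` A j) x = fine (P (A i `&` A j)).
  by rewrite -mean_indic.
rewrite !meanZ//; last exact: bounded_mfun_cst.
by rewrite !EA EI mean_cst; ring.
Qed.

Let cov_le1 i j : \int[P]_x (Y i x * Y j x) <= 1.
Proof.
rewrite centered_cov lerBlDr; have mI : measurable (A i `&` A j).
  exact: measurableI.
have : fine (P (A i `&` A j)) <= 1.
  by rewrite -lee_fin fineK ?fin_num_measure//; exact: probability_le1.
by have := mulr_ge0 (andP q01).1 (andP q01).1; lra.
Qed.

(** Only the indices less than [m] below [n] contribute, by at most 1 each. The
    truncated subtraction counts them. *)
Lemma centered_sum_cov n k :
  \int[P]_x (X k x * Y n x) <= ((k + m) - n)%N%:R.
Proof.
elim: k => [|k IH].
  rewrite (_ : \int[P]_x _ = 0) ?ler0n//.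
  rewrite -[RHS](@mean_cst _ _ _ P); apply: eq_Rintegral => x _.
  by rewrite /X big_ord0 mul0r.
have -> : \int[P]_x (X k.+1 x * Y n x) =
    \int[P]_x (X k x * Y n x) + \int[P]_x (Y k x * Y n x).
  rewrite -meanD; try exact: bounded_mfunM.
  by apply: eq_Rintegral => x _; rewrite /X big_ord_recr /= mulrDl.
have [kn|nk] := leqP (k + m) n.
  rewrite centered_cov PAA// subrr addr0 (le_trans IH)// ler_nat.
  by rewrite leq_sub2r// leq_add2r.
by rewrite addSn subSn ?(ltnW nk)// -natr1 lerD.
Qed.

(** Expand the square at the last term of the sum: each step adds twice a
    covariance with the past, at most [m], and a variance, at most 1. *)
Lemma second_moment_le n : \int[P]_x (X n x * X n x) <= (m.*2.+1 * n)%N%:R.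
Proof.
elim: n => [|n IH].
  rewrite (_ : \int[P]_x _ = 0) ?ler0n//.
  rewrite -[RHS](@mean_cst _ _ _ P); apply: eq_Rintegral => x _.
  by rewrite /X big_ord0 mul0r.
have -> : \int[P]_x (X n.+1 x * X n.+1 x) = \int[P]_x (X n x * X n x) +
    (2 * \int[P]_x (X n x * Y n x) + \int[P]_x (Y n x * Y n x)).
  have bXY : bounded_mfun (fun x => X n x * Y n x) by exact: bounded_mfunM.
  have bYY : bounded_mfun (fun x => Y n x * Y n x) by exact: bounded_mfunM.
  have bXX : bounded_mfun (fun x => X n x * X n x) by exact: bounded_mfunM.
  have b2 := bounded_mfunZ 2 bXY.
  rewrite -meanZ// -meanD// -meanD//; last exact: bounded_mfunD.
  by apply: eq_Rintegral => x _; rewrite /X big_ord_recr /=; ring.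
have := centered_sum_cov n n; rewrite addnC addnK => c1.
rewrite mulnS natrD addrC lerD// -muln2 -[in leRHS]natr1 natrM.
by have := cov_le1 n n; lra.
Qed.


(** Along the squares [N k = (k + 1) ^ 2] the normalized centred sums have second
    moments of order [1 / N k]. These are summable, so the series of the squares
    [Z k] has a finite integral, is finite almost surely, and its terms tend to
    0. *)
Lemma frequency_cvg : {ae P, forall w,
  n%:R^-1 * \sum_(i < n) \1_(A i) w @[n --> \oo] --> q}.
Proof.
pose N k := (k.+1 * k.+1)%N.
have N0 k : 0 < (N k)%:R :> R by rewrite ltr0n.
pose Z k x := (X (N k) x / (N k)%:R) ^+ 2.
have bZ k : bounded_mfun (Z k).
  have bXN : bounded_mfun (fun x => X (N k) x / (N k)%:R).
    by apply: bounded_mfunM => //; exact: bounded_mfun_cst.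
  exact: bounded_mfunM.
have Z0 k x : 0 <= Z k x by exact: sqr_ge0.
have EZ k : \int[P]_x Z k x <= m.*2.+1%:R * (N k)%:R^-1.
  have -> : \int[P]_x Z k x =
      ((N k)%:R^-1 * (N k)%:R^-1) * \int[P]_x (X (N k) x * X (N k) x).
    rewrite -meanZ; last exact: bounded_mfunM.
    by apply: eq_Rintegral => x _; rewrite /Z; ring.
  rewrite -mulrA ler_pdivrMl// mulrCA divff ?gt_eqF// mulr1.
  by rewrite ler_pdivrMl// mulrC -natrM; exact: second_moment_le.
have intZ k : (\int[P]_x (Z k x)%:E)%E = (\int[P]_x Z k x)%:E.
  by rewrite /Rintegral fineK//; apply: integrable_fin_num => //;
    exact: bounded_mfun_integrable.
have mZ k : measurable_fun [set: T] (EFin \o Z k).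
  by apply/measurable_EFinP; case: (bZ k).
have mS : measurable_fun [set: T] (fun x => \sum_(k <oo) (Z k x)%:E)%E.
  apply: ge0_emeasurable_sum => [k x _ _|k _]; first by rewrite lee_fin.
  exact: mZ.
have ifin : P.-integrable [set: T] (fun x => \sum_(k <oo) (Z k x)%:E)%E.
  apply/integrableP; split=> //.
  have -> : (\int[P]_x `|\sum_(k <oo) (Z k x)%:E| =
      \int[P]_x \sum_(k <oo) (Z k x)%:E)%E.
    apply: eq_integral => x _; rewrite gee0_abs//.
    by apply: nneseries_ge0 => *; rewrite lee_fin.
  rewrite integral_nneseries//=; last by move=> *; rewrite lee_fin.
  apply: (@le_lt_trans _ _ (m.*2.+1%:R * 2)%:E); last exact: ltey.
  apply: lime_le.
    by apply: is_cvg_nneseries => *; rewrite intZ lee_fin Rintegral_ge0.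
  apply: nearW => n; rewrite big_mkord; under eq_bigr do rewrite intZ.
  rewrite sumEFin lee_fin (@le_trans _ _ (\sum_(k < n) m.*2.+1%:R * (N k)%:R^-1))//.
    exact: ler_sum.
  by rewrite -mulr_sumr ler_pM2l// sum_inv_sqr_le.
have := integrable_ae measurableT ifin; apply: filterS => w /(_ I) Sw.
have Zcvg : Z k w @[k --> \oo] --> (0 : R).
  apply: cvg_series_cvg_0; apply: nondecreasing_is_cvgn.
    by apply: nondecreasing_series => *.
  exists (fine (\sum_(k <oo) (Z k w)%:E)%E) => _ [n _ <-].
  rewrite -lee_fin fineK// /series /= -sumEFin.
  by apply: nneseries_lim_ge => *; rewrite lee_fin.
have XS n : `|X n.+1 w - X n w| <= 1.
  by rewrite /X big_ord_recr /= addrAC subrr add0r.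
have := cvg_of_squares XS Zcvg.
have -> : (fun n => X n w / n%:R) =
    (fun n => if n == 0%N then 0 else n%:R^-1 * \sum_(i < n) \1_(A i) w - q).
  apply/funext => n; rewrite /X; case: n => [|n] /=; first by rewrite big_ord0 mul0r.
  rewrite /Y sumrB sumr_const card_ord mulrBl mulrC; congr (_ - _).
  by rewrite -[q *+ _]mulr_natr mulfK.
move=> c0; rewrite -[X in _ --> X]add0r.
have : (if n == 0%N then 0 else n%:R^-1 * \sum_(i < n) \1_(A i) w - q) + q
    @[n --> \oo] --> 0 + q by apply: cvgD => //; exact: cvg_cst.
apply: cvg_trans; apply: near_eq_cvg; near=> n.
case: ifPn => [/eqP n0|_]; last by rewrite subrK.
suff : (0 < n)%N by rewrite n0.
by near: n; exists 1%N.
Unshelve. all: by end_near. Qed.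

End frequency.

(** * Growth of a recurrence driven by a fixed sequence of signs *)

Section reaching_the_cone.
Context {R : realType}.
Variables (lambda : R).
Hypothesis h : 2 <= lambda.

Definition next_term (c : bool) (uv : R * R) : R :=
  if c then lambda * uv.2 + uv.1 else lambda * uv.2 - uv.1.

(** If both entries of [uv] are nonzero, this is the only letter with which the
    next ratio may stay below [B]: it makes the two terms of the
    recurrence cancel each other. *)
Definition bad_letter (uv : R * R) : bool := uv.1 * uv.2 < 0.

Definition bad_pair (uv0 : R * R) n : R * R :=
  iter n (fun uv => (uv.2, next_term (bad_letter uv) uv)) uv0.

Lemma bad_pairS uv0 n : bad_pair uv0 n.+1 = ((bad_pair uv0 n).2,
  next_term (bad_letter (bad_pair uv0 n)) (bad_pair uv0 n)).
Proof. by []. Qed.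

(** With the other letter the two terms have the same sign, so the next ratio is
    at least [lambda]. If the last term is 0, both letters make the next ratio
    infinite, which the reciprocal in the conclusion allows. *)
Lemma next_term_cone c uv : uv != (0, 0) -> c != bad_letter uv ->
  next_term c uv != 0 /\ 0 <= uv.2 / next_term c uv <= (B_ lambda)^-1.
Proof.
case: uv => u v; rewrite /bad_letter /next_term /= => uv0 cbad.
have Bi : 0 < (B_ lambda)^-1 by rewrite invr_gt0 B_gt0.
have [v0|v0] := eqVneq v 0.
  subst v; move: uv0; rewrite xpair_eqE eqxx andbT => u0.
  rewrite mulr0 mul0r lexx (ltW Bi); split=> //.
  by case: (c); rewrite ?add0r ?oppr_eq0.
have -> : (if c then lambda * v + u else lambda * v - u) =
    v * (lambda + `|u / v|).
  have uvE : u / v = u * v / v ^+ 2 by field.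
  have v2 : 0 < v ^+ 2 by rewrite exprn_even_gt0.
  case: c cbad => /= cbad.
    have uv1 : 0 <= u / v.
      by rewrite uvE divr_ge0 ?(ltW v2)// leNgt; move: cbad; case: (_ < _).
    by rewrite ger0_norm//; field.
  have uv1 : u / v < 0.
    by rewrite uvE pmulr_llt0 ?invr_gt0//; move: cbad; case: (_ < _).
  by rewrite ltr0_norm//; field.
have l0 : 0 < lambda + `|u / v|.
  by apply: ltr_pwDl => //; apply: lt_le_trans h.
split; first by rewrite mulf_neq0// gt_eqF.
rewrite invfM mulrA divff// mul1r invr_ge0 (ltW l0) lef_pV2 ?posrE ?B_gt0//=.
by have := B_addV h; have := normr_ge0 (u / v); lra.
Qed.

Variables (b : nat -> bool) (F : nat -> R).
Hypothesis FE : forall n, (1 <= n)%N ->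
  F n.+2 = if b n then lambda * F n.+1 + F n else lambda * F n.+1 - F n.

(** Up to the first letter that differs from the bad one, the recurrence follows
    the bad path; at this letter it enters the cone. *)
Lemma eventually_cone : (F 1%N, F 2%N) != (0, 0) ->
  (exists n, b n.+1 != bad_letter (bad_pair (F 1%N, F 2%N) n)) ->
  exists n0, [/\ (1 <= n0)%N, F n0.+1 != 0
    & 0 <= F n0 / F n0.+1 <= (B_ lambda)^-1].
Proof.
move=> F0 exb; case: (ex_minnP exb) => n bn nmin.
have badE k : (k <= n)%N -> bad_pair (F 1%N, F 2%N) k = (F k.+1, F k.+2).
  elim: k => [//|k IH] kn; rewrite bad_pairS IH ?(ltnW kn)//.
  have -> : bad_letter (F k.+1, F k.+2) = b k.+1.
    apply/esym/eqP/negPn/negP => bk; move: (nmin k); rewrite IH ?(ltnW kn)//.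
    by rewrite leqNgt kn => /(_ bk).
  by rewrite [F k.+3]FE// /next_term.
have Fneq k : (F k.+1, F k.+2) != (0, 0).
  elim: k => [//|k]; apply: contra => /eqP[Fk2 Fk3]; rewrite xpair_eqE Fk2 eqxx andbT.
  by move: Fk3; rewrite FE// Fk2 mulr0; case: (b _) => /eqP; rewrite ?add0r ?oppr_eq0.
move: bn; rewrite badE// => bn; exists n.+2.
have [] := next_term_cone (Fneq n) bn.
by rewrite /next_term /= -FE.
Qed.

End reaching_the_cone.

Section growth_along_a_sequence.
Context {R : realType}.
Variables (lambda p gamma : R) (b : nat -> bool) (F : nat -> R).
Hypothesis h : 2 <= lambda.

(** Signs are numbered from 1, hence the shift. *)
Definition window m i : seq bool := mkseq (fun j => b (i.+1 + j)) m.

Lemma sum_windows m (g : seq bool -> R) n :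
  \sum_(i < n) g (window m i) =
  \sum_(W <- words m) g W * \sum_(i < n) (window m i == W)%:R.
Proof.
under [RHS]eq_bigr do rewrite mulr_sumr.
rewrite exchange_big /=; apply: eq_bigr => i _.
rewrite (bigD1_seq (window m i)) ?words_uniq//=; last first.
  by rewrite -[X in words X](size_mkseq (fun j => b (i.+1 + j)) m) mem_words.
rewrite eqxx mulr1 big1 ?addr0// => W Wi.
by rewrite eq_sym (negbTE Wi) mulr0.
Qed.

Hypothesis FE : forall n, (1 <= n)%N ->
  F n.+2 = if b n then lambda * F n.+1 + F n else lambda * F n.+1 - F n.
Variable n0 : nat.
Hypothesis n01 : (1 <= n0)%N.
Hypothesis Fn0 : F n0.+1 != 0.
Hypothesis cone : 0 <= F n0 / F n0.+1 <= (B_ lambda)^-1.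

(** The hypothesis [cone] bounds the inverse of the ratio at [n0], because
    [F n0] may be 0; from the next index on the ratio itself is finite. *)
Let x k := F k.+1 / F k.
Let B0 : 0 < B_ lambda. Proof. exact: B_gt0. Qed.
Let B1 : 1 <= B_ lambda. Proof. exact: B_ge1. Qed.

Lemma ratio_succ k : (1 <= k)%N -> F k != 0 -> F k.+1 != 0 ->
  x k.+1 = mobius lambda (b k) (x k).
Proof.
move=> k1 Fk Fk1; rewrite /x FE// /mobius; case: (b k);
by field; rewrite Fk Fk1.
Qed.

Lemma ratio_ge k : (n0 < k)%N -> F k != 0 /\ B_ lambda <= x k.
Proof.
elim: k => [//|k IH]; rewrite ltnS leq_eqVlt => /predU1P[<-|n0k].
  split=> //; have hB := B_addV h; move: cone => /andP[c0 c1].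
  have -> : x n0.+1 = if b n0 then lambda + F n0 / F n0.+1
      else lambda - F n0 / F n0.+1.
    by rewrite /x FE//; case: (b n0); field.
  by move: (F n0 / F n0.+1) c0 c1 hB => r; case: (b n0) => *; lra.
have [Fk Bx] := IH n0k.
have Fk1 : F k.+1 != 0.
  apply/eqP => Fk1; move: Bx; rewrite /x Fk1 mul0r leNgt.
  by rewrite B0.
split=> //; rewrite ratio_succ//; last exact: leq_trans n0k.
by case/andP: (mobius_bound (b k) h Bx).
Qed.

Lemma ratio_window m i : (n0 <= i)%N ->
  x (i.+1 + m) = mobius_word lambda (window m i) (x i.+1).
Proof.
move=> n0i; elim: m => [|m IH]; first by rewrite addn0.
rewrite addnS ratio_succ.
- by rewrite /window mkseqS -cats1 /mobius_word foldl_cat /= -[foldl _ _ _]IH.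
- by rewrite addSn.
- by apply: (ratio_ge _).1; rewrite ltnS (leq_trans n0i)// leq_addr.
- by apply: (ratio_ge _).1; rewrite ltnS leqW// (leq_trans n0i)// leq_addr.
Qed.

Lemma ln_succ k : (n0 < k)%N -> ln `|F k.+1| = ln `|F k| + ln (x k).
Proof.
move=> n0k; have [Fk Bx] := ratio_ge n0k.
have x0 : 0 < x k by exact: lt_le_trans Bx.
rewrite -lnM ?posrE ?normr_gt0// -[x k]gtr0_norm// -normrM /x.
by rewrite mulrC divfK.
Qed.


Let M := ln (lambda + (B_ lambda)^-1).

Lemma ln_ratio_bound k : (n0.+1 < k)%N -> `|ln (x k)| <= M.
Proof.
case: k => [//|k]; rewrite ltnS => n0k; have [Fk Bx] := ratio_ge n0k.
have [Fk1 _] := ratio_ge (leqW n0k).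
have /andP[x1 x2] := mobius_bound (b k) h Bx.
have k1 : (1 <= k)%N by exact: leq_trans n0k.
rewrite ratio_succ// ger0_norm ?ln_ge0 ?(le_trans B1)//.
by rewrite ler_ln ?posrE ?(lt_le_trans B0)// (le_trans x1).
Qed.

Lemma ln_shift_bound n j : (n0.+1 < n)%N ->
  `|ln `|F (n + j)| - ln `|F n| | <= j%:R * M.
Proof.
move=> n0n; elim: j => [|j IH]; first by rewrite addn0 subrr normr0 mul0r.
rewrite addnS ln_succ ?(leq_trans (ltnW n0n))// ?leq_addr//.
rewrite addrAC (le_trans (ler_normD _ _))// -natr1 mulrDl mul1r lerD//.
by apply: ln_ratio_bound; rewrite (leq_trans n0n)// leq_addr.
Qed.

Let g W := ln (mobius_word lambda W (B_ lambda)).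

Lemma ln_window m i : (n0 <= i)%N -> m%:R * `|ln (x (i.+1 + m)) - g (window m i)| <= 1.
Proof.
move=> n0i; have [_ Bx] := @ratio_ge i.+1 n0i.
rewrite ratio_window// (le_trans _ (mobius_word_contract (window m i) h Bx (lexx _)))//.
rewrite size_mkseq ler_wpM2l//; apply: ln_dist_le;
  by rewrite (le_trans B1)// mobius_word_ge.
Qed.

Let L m n := ln `|F (n.+1 + m)| - \sum_(i < n) g (window m i).

(** Each step adds the difference between the logarithm of a ratio and its
    approximation by the preceding window. *)
Lemma ln_windows_sum m j : (0 < m)%N ->
  `|L m (n0 + j)%N - L m n0| <= j%:R / m%:R.
Proof.
move=> m0; have mR : 0 < m%:R :> R by rewrite ltr0n.
elim: j => [|j IH]; first by rewrite addn0 subrr normr0 mul0r.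
have -> : L m (n0 + j.+1)%N - L m n0 = (L m (n0 + j)%N - L m n0) +
    (ln (x ((n0 + j).+1 + m)) - g (window m (n0 + j))).
  rewrite /L addnS big_ord_recr /= addSn ln_succ; last first.
    by rewrite addSn ltnS -addnA leq_addr.
  ring.
rewrite (le_trans (ler_normD _ _))// -natr1 mulrDl lerD// mul1r.
by rewrite -[leRHS]mulr1 ler_pdivlMl// ln_window// leq_addr.
Qed.

(** The error has four parts: the bounded contribution [C] of the start and of the
    shift by [m] of the windows, the approximation of each logarithm, the
    convergence of the frequencies, and the approximation of [gamma] by the mean
    over words. With [m] at least [4 / e] each of them is at most [e / 4]. *)
Lemma log_average_cvg :
  (forall W, n%:R^-1 * \sum_(i < n) (window (size W) i == W)%:R @[n --> \oo] -->
     word_prob p W) ->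
  (forall m, m%:R * `|gamma - \sum_(X <- words m) word_prob p X * g X| <= 1) ->
  n%:R^-1 * ln `|F n| @[n --> \oo] --> gamma.
Proof.
move=> freq gammaE; apply/cvgrPdist_le => e e0.
pose m := (Num.truncn (4 / e)).+1.
have m0 : 0 < m%:R :> R by rewrite ltr0n.
have me : 4 / m%:R <= e.
  rewrite ler_pdivrMr// mulrC -ler_pdivrMr//.
  exact: (ltW (truncnS_gt _)).
pose S := \sum_(X <- words m) word_prob p X * g X.
have Sc : n%:R^-1 * \sum_(i < n) g (window m i) @[n --> \oo] --> S.
  have -> : (fun n => n%:R^-1 * \sum_(i < n) g (window m i)) =
      (fun n => \sum_(W <- words m) (n%:R^-1 * \sum_(i < n) (window m i == W)%:R) * g W).
    apply/funext => n; rewrite sum_windows mulr_sumr; apply: eq_bigr => W _.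
    by rewrite mulrCA mulrC.
  rewrite /S.
  have : {subset words m <= words m} by [].
  elim: {1 3 4}(words m) => [|W ws IH] sub.
    under eq_fun do rewrite big_nil; rewrite big_nil; exact: cvg_cst.
  under eq_fun do rewrite big_cons; rewrite big_cons.
  apply: cvgD; last by apply: IH => V Vws; apply: sub; rewrite inE Vws orbT.
  apply: cvgM; last exact: cvg_cst.
  have /size_words sW : W \in words m by apply: sub; rewrite inE eqxx.
  by have := freq W; rewrite sW.
have d0 : 0 < m%:R^-1 :> R by rewrite invr_gt0.
have /cvgrPdist_le /(_ _ d0) [K1 _ hK1] := Sc.
pose C := `|L m n0| + m.+1%:R * M.
pose K2 := (Num.truncn (C * m%:R)).+1.
exists (maxn n0.+2 (maxn K1 K2)) => // n /=.
rewrite !geq_max => /and3P[n0n K1n K2n].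
have nR : 0 < n%:R :> R by rewrite ltr0n (leq_trans _ n0n).
have a1 : `|S - n%:R^-1 * \sum_(i < n) g (window m i)| <= m%:R^-1 := hK1 n K1n.
have a2 : `|gamma - S| <= m%:R^-1.
  by rewrite -[leRHS]mulr1 ler_pdivlMl//; exact: gammaE.
have a3 : `|ln `|F n| - \sum_(i < n) g (window m i)| <= C + n%:R / m%:R.
  have c1 := ln_shift_bound m.+1 n0n.
  have c2 := @ln_windows_sum m (n - n0) (ltn0Sn _).
  have nn0 : (n0 + (n - n0) = n)%N by rewrite subnKC// ltnW// ltnW.
  have c3 : (n - n0)%N%:R / m%:R <= n%:R / m%:R :> R.
    by rewrite ler_pM2r// ler_nat leq_subr.
  move: c2; rewrite nn0 => c2.
  have -> : ln `|F n| - \sum_(i < n) g (window m i) =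
      - (ln `|F (n + m.+1)| - ln `|F n|) + ((L m n - L m n0) + L m n0).
    by rewrite /L addnS addSn; ring.
  rewrite (le_trans (ler_normD _ _))// normrN /C [leRHS]addrAC addrC lerD//.
  by rewrite (le_trans (ler_normD _ _))// addrC lerD// (le_trans c2).
have a4 : n%:R^-1 * C <= m%:R^-1.
  rewrite ler_pdivrMl// ler_pdivlMr// (le_trans (ltW (truncnS_gt _)))// ler_nat.
  exact: K2n.
have a5 : `|n%:R^-1 * \sum_(i < n) g (window m i) - n%:R^-1 * ln `|F n| |
    <= n%:R^-1 * C + m%:R^-1.
  rewrite -mulrBr normrM ger0_norm ?invr_ge0// distrC.
  rewrite (le_trans (ler_wpM2l _ a3)) ?invr_ge0// mulrDr mulrA mulVf ?gt_eqF//.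
  by rewrite mul1r.
rewrite (le_trans _ me)// -(subrKA S) (le_trans (ler_normD _ _))//.
rewrite -(subrKA (n%:R^-1 * \sum_(i < n) g (window m i)) S).
have := ler_normD (S - n%:R^-1 * \sum_(i < n) g (window m i))
  (n%:R^-1 * \sum_(i < n) g (window m i) - n%:R^-1 * ln `|F n|).
lra.
Qed.

End growth_along_a_sequence.

(** * Random signs *)

Section random_letters.
Context {R : realType} (p : R) d (Omega : measurableType d).
Variables (P : probability Omega R) (s : nat -> {RV P >-> bool}).
Hypotheses (p0 : 0 < p) (p1 : p <= 1).
Hypothesis s_indep : mutually_independent P [set n : nat | (1 <= n)%N] s.
Hypothesis s_true : forall n, (1 <= n)%N -> P (s n @^-1` [set true]) = p%:E.
Hypothesis s_false :
  forall n, (1 <= n)%N -> P (s n @^-1` [set false]) = (1 - p)%:E.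

(** The signs indexed by [J] are those prescribed by [a]. *)
Definition letters_event (J : seq nat) (a : nat -> bool) : set Omega :=
  [set w | forall k, k \in J -> s k w = a k].

Lemma letters_eventE J a : letters_event J a =
  \bigcap_(k in [set` J]) (s k @^-1` [set a k]).
Proof. by []. Qed.

Lemma letters_event_measurable J a : measurable (letters_event J a).
Proof.
rewrite letters_eventE bigcap_seq; apply: bigsetI_measurable => k _.
by rewrite -[X in measurable X]setTI; exact: measurable_funP.
Qed.

Lemma letters_event_prob J a : uniq J -> (forall k, k \in J -> (1 <= k)%N) ->
  fine (P (letters_event J a)) = \prod_(k <- J) letter_prob p (a k).
Proof.
move=> uJ J1; rewrite letters_eventE (s_indep (A := fun k => [set a k]))//.
rewrite (_ : (\prod_(k <- J) P (s k @^-1` [set a k]))%E =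
  (\prod_(k <- J) letter_prob p (a k))%:E)//.
rewrite -prodEFin big_seq [RHS]big_seq; apply: eq_bigr => k /J1 k1.
by rewrite /letter_prob; case: (a k); [exact: s_true|exact: s_false].
Qed.

Lemma letters_eventI J1 J2 a1 a2 a :
  (forall k, k \in J1 -> a k = a1 k) -> (forall k, k \in J2 -> a k = a2 k) ->
  letters_event J1 a1 `&` letters_event J2 a2 = letters_event (J1 ++ J2) a.
Proof.
move=> h1 h2; apply/seteqP; split=> [w [w1 w2] k|w wk].
  by rewrite mem_cat => /orP[] kJ; [rewrite w1// h1|rewrite w2// h2].
by split=> k kJ; [rewrite -h1//|rewrite -h2//]; apply: wk;
  rewrite mem_cat kJ ?orbT.
Qed.

Let word_at W i k := nth false W (k - i.+1).

Lemma window_event W i : [set w | window (fun n => s n w) (size W) i = W] =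
  letters_event (iota i.+1 (size W)) (word_at W i).
Proof.
apply/seteqP; split=> w /=.
  move=> wW k; rewrite mem_iota => /andP[ik kW].
  rewrite /word_at -wW nth_mkseq; first by rewrite subnKC.
  by rewrite ltn_subLR.
move=> wk; apply: (@eq_from_nth _ false); first by rewrite size_mkseq.
rewrite size_mkseq => j jW; rewrite nth_mkseq// wk.
  by rewrite /word_at addKn.
by rewrite mem_iota leq_addr /= ltn_add2l.
Qed.

Lemma prod_word_at W i :
  \prod_(k <- iota i.+1 (size W)) letter_prob p (word_at W i k) = word_prob p W.
Proof.
rewrite -[i.+1]addn0 iotaDl big_map /word_prob (big_nth false).
rewrite /index_iota subn0; apply: eq_bigr => j _.
by rewrite /word_at addKn.
Qed.

Lemma window_frequency W : {ae P, forall w,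
  n%:R^-1 * \sum_(i < n) (window (fun n => s n w) (size W) i == W)%:R
    @[n --> \oo] --> word_prob p W}.
Proof.
pose A i := [set w | window (fun n => s n w) (size W) i = W].
have mA i : measurable (A i).
  by rewrite /A window_event; exact: letters_event_measurable.
have PA i : fine (P (A i)) = word_prob p W.
  rewrite /A window_event letters_event_prob ?iota_uniq ?prod_word_at//.
  by move=> k; rewrite mem_iota => /andP[/(leq_trans _)->].
have PAA i j : (i + size W <= j)%N ->
    fine (P (A i `&` A j)) = word_prob p W * word_prob p W.
    (* The two windows do not overlap, so one assignment prescribes both. *)
  move=> ij; pose a k := if (k < j.+1)%N then word_at W i k else word_at W j k.
  have a1 k : k \in iota i.+1 (size W) -> a k = word_at W i k.
    rewrite mem_iota /a => /andP[_ ki]; rewrite ifT//.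
    by rewrite (leq_trans ki)// addSn ltnS.
  have a2 k : k \in iota j.+1 (size W) -> a k = word_at W j k.
    by rewrite mem_iota /a => /andP[jk _]; rewrite ltnNge jk.
  rewrite /A !window_event (letters_eventI a1 a2) letters_event_prob.
  - rewrite big_cat /= -{1}(prod_word_at W i) -(prod_word_at W j).
    by congr (_ * _); apply: eq_big_seq => k kJ; [rewrite a1|rewrite a2].
  - rewrite cat_uniq !iota_uniq andbT /=; apply/hasPn => k.
    rewrite !mem_iota => /andP[jk _]; apply/negP => /andP[_].
    rewrite addSn ltnS => ki; move: jk.
    by rewrite ltnNge (leq_trans ki ij).
  - by move=> k; rewrite mem_cat !mem_iota => /orP[] /andP[/(leq_trans _)->].
apply: filterS (frequency_cvg mA PA PAA) => w; apply: cvg_trans.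
apply: near_eq_cvg; apply: nearW => n; congr (_ * _); apply: eq_bigr => i _.
rewrite indicE; congr (_%:R); congr nat_of_bool.
by apply/idP/eqP => [/set_mem|wW]; [|apply/mem_set].
Qed.

(** The probability that the first [n] signs are prescribed is at most
    [r ^ n] with [r = max p (1 - p)]. If [p = 1], [r] is 1, but then the first
    prescribed sign has probability [1 - p = 0]. *)
Lemma letters_differ (a : nat -> bool) : a 1%N = false ->
  {ae P, forall w, exists n, s n.+1 w != a n.+1}.
Proof.
move=> a1; pose N n := letters_event (iota 1 n) a.
have mN n : measurable (N n) by exact: letters_event_measurable.
have PN n : fine (P (N n)) = \prod_(k <- iota 1 n) letter_prob p (a k).
  rewrite letters_event_prob ?iota_uniq//.
  by move=> k; rewrite mem_iota => /andP[].
exists (\bigcap_n N n); split.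
- exact: bigcapT_measurable.
- have mI : measurable (\bigcap_n N n) by exact: bigcapT_measurable.
  apply: prob_eq0 => //; apply/eqP; rewrite eq_le fine_ge0// andbT.
  have leN n : fine (P (\bigcap_n N n)) <= fine (P (N n)).
    by apply: fine_prob_le => // w; exact.
  have [pE|pN] := eqVneq p 1.
    by rewrite (le_trans (leN 1%N))// PN big_seq1 a1 /letter_prob pE subrr.
  pose r := Num.max p (1 - p).
  have r0 : 0 <= r by rewrite le_max (ltW p0).
  have r1 : `|r| < 1.
    by rewrite ger0_norm// gt_max lt_neqAle pN p1 ltrBlDr ltrDl.
  have rN n : fine (P (N n)) <= r ^+ n.
    rewrite PN; elim: n 1%N => [|n IH] k; first by rewrite big_nil expr0.
    rewrite /= big_cons exprS; apply: ler_pM => //.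
    - by rewrite /letter_prob; case: (a k); rewrite ?subr_ge0// ltW.
    - apply: prodr_ge0 => j _; rewrite /letter_prob.
      by case: (a j); rewrite ?subr_ge0// ltW.
    - by rewrite /letter_prob /r le_max; case: (a k); rewrite lexx ?orbT.
  rewrite leNgt; apply/negP => N0.
  have /cvgr_lt /(_ _ N0) [n _ /(_ n (leqnn n))] := cvg_expr r1.
  by rewrite /= ltNge (le_trans (leN n)).
- move=> w /= nw n _ k; rewrite mem_iota => /andP[k1 _].
  apply/eqP/negPn/negP => sk; apply: nw; exists k.-1.
  by rewrite prednK.
Qed.

End random_letters.

(** * Almost sure growth rate *)

Theorem theorem1p3 (R : realType) (lambda p : R)
    (hlambda : 2 <= lambda) (hp0 : 0 < p) (hp1 : p <= 1) :
  exists mu : probability (measurableTypeR R) R,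
    [/\ is_mu lambda p mu,
        forall nu : probability (measurableTypeR R) R, is_mu lambda p nu ->
          forall A : set (measurableTypeR R), measurable A -> nu A = mu A,
        mu.-integrable `]0, +oo[ (fun x : R => (ln x)%:E),
        0 < \int[mu]_(x in `]0, +oo[) ln x
      & forall (d : measure_display) (Omega : measurableType d)
          (P : probability Omega R)
          (s : nat -> {RV P >-> bool})
          (F1 F2 : R) (F : nat -> Omega -> R),
          mutually_independent P [set n : nat | (1 <= n)%N] s ->
          (forall n : nat, (1 <= n)%N -> P (s n @^-1` [set true]) = p%:E) ->
          (forall n : nat, (1 <= n)%N ->
             P (s n @^-1` [set false]) = (1 - p)%:E) ->
          0 < F1 -> 0 < F2 ->
          (forall w : Omega, F 1%N w = F1) ->
          (forall w : Omega, F 2%N w = F2) ->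
          (forall (n : nat) (w : Omega), (1 <= n)%N ->
             F n.+2 w =
               if s n w then lambda * F n.+1 w + F n w
               else lambda * F n.+1 w - F n w) ->
          {ae P, forall w : Omega,
             ((n%:R^-1)%:E * lne (`|F n w|%:E))%E @[n --> \oo] -->
               (\int[mu]_(x in `]0, +oo[) ln x)%:E} ].
Proof.
have [mu muP] := is_mu_exists hlambda hp0 hp1.
exists mu; split=> //.
- by move=> nu nuP; exact: (is_mu_unique hlambda hp0 hp1 muP nuP).
- exact: (ln_integrable hlambda muP).
- exact: (log_integral_gt0 hlambda hp0 muP).
move=> d Omega P s F1 F2 F s_indep s_true s_false F1gt0 F2gt0 FE1 FE2 FE.
(* There are countably many words, so one null set serves for all of them. *)
have freq : {ae P, forall w, forall W : seq bool,
    n%:R^-1 * \sum_(i < n) (window (fun n => s n w) (size W) i == W)%:R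
      @[n --> \oo] --> word_prob p W}.
  have : {ae P, forall w, forall k, let W := odflt [::] (unpickle k) in
      n%:R^-1 * \sum_(i < n) (window (fun n => s n w) (size W) i == W)%:R
        @[n --> \oo] --> word_prob p W}.
    by apply: ae_foralln => k; exact: window_frequency.
  apply: filterS => w wk W; have := wk (pickle W); by rewrite pickleK.
(* Both initial values are positive, so the first bad letter is [L]. *)
have bad1 : bad_letter (bad_pair lambda (F1, F2) 0) = false.
  by apply/negbTE; rewrite -leNgt mulr_ge0// ltW.
have := letters_differ hp0 hp1 s_indep s_true s_false
  (a := fun k => bad_letter (bad_pair lambda (F1, F2) k.-1)) bad1.
apply: filterS2 freq => w wfreq [k sk].
have FEw n : (1 <= n)%N -> F n.+2 w = if s n w then lambda * F n.+1 w + F n w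
    else lambda * F n.+1 w - F n w by move=> n1; exact: FE.
have [n0 [n01 Fn0 Fcone]] : exists n0, [/\ (1 <= n0)%N, F n0.+1 w != 0
    & 0 <= F n0 w / F n0.+1 w <= (B_ lambda)^-1].
  apply: (eventually_cone hlambda FEw); rewrite FE1 FE2.
    by rewrite xpair_eqE gt_eqF.
  by exists k.
have := log_average_cvg hlambda FEw n01 Fn0 Fcone wfreq
  (log_integral_words hlambda hp0 hp1 muP).
move=> lnF; apply/fine_cvgP.
have FnE : \forall n \near \oo,
    ((n%:R^-1)%:E * lne (`|F n w|%:E))%E = (n%:R^-1 * ln `|F n w|)%:E.
  exists n0.+1 => // n n0n.
  have [Fn _] := ratio_ge hlambda FEw n01 Fn0 Fcone n0n.
  by rewrite lne_EFin ?normr_gt0.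
split; first by apply: filterS FnE => n ->.
apply: cvg_trans lnF; apply: near_eq_cvg.
by apply: filterS FnE => n /= ->.
Qed.
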